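(* Let $u\in\{0,1,2\}$, and let the coefficients $\mu_I\ge0$ ($I\in\mathscr{D}^u$), the measure $\mu$ on $\mathbb{R}^2$, the Carleson boxes $\hat J$ and the dyadic Poisson integrals $Q^u$ be as in the context. There is a finite constant $\mathcal{Q}$ such that $$\sum_{I\in\mathscr{D}^u}\mu_I\cdot Q^u(1_{I^c}h\,dw,I)^2\le\mathcal{Q}^2\|h\|_{L^2(w)}^2\qquad\text{for all }h\in L^2(w)$$ if and only if $$\mathcal{U}:=\sup_{J\in\mathscr{D}^u}\frac{1}{|\hat J|}w(J^{(1)}\setminus J)^{1/2}\mu(\hat J)^{1/2}<\infty,$$ $$\mathcal{T}:=\sup_{J\in\mathscr{D}^u}\frac{1}{w(J)^{1/2}}\Big\|\sum_{I\in\mathscr{D}^u:\,I\subsetneq J}\frac{1_{\hat I}}{|\hat I|}w(I^{(1)}\setminus I)\Big\|_{L^2(\mu)}<\infty,$$ $$\mathcal{T}^*:=\sup_{J\in\mathscr{D}^u}\frac{1}{\mu(\hat J)^{1/2}}\Big\|\sum_{I\in\mathscr{D}^u:\,I\subsetneq J}1_{I^{(1)}\setminus I}\frac{\mu(\hat I)}{|\hat I|}\Big\|_{L^2(w)}<\infty.$$ Moreover, the best constant satisfies $\mathcal{Q}\eqsim\mathcal{U}+\mathcal{T}+\mathcal{T}^*$ with absolute implied constants.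
   Context: $\sigma,w$ are Radon measures on $\mathbb{R}$, and $\mathscr{D}$ is a system of half-open dyadic intervals on $\mathbb{R}$. The tripled intervals $\{3I:I\in\mathscr{D}\}$ (same centre, triple length) are partitioned into three subcollections $\mathscr{D}^u$, $u=0,1,2$, each of which is a dyadic system (in the sense of nesting and covering) with interval lengths $3\cdot2^k$. For $I\in\mathscr{D}^u$, $I^{(j)}$ is its $j$th dyadic ancestor within $\mathscr{D}^u$ ($I^{(0)}=I$). For an interval $K$, $I^u(K)$ is the unique (if it exists) $I\in\mathscr{D}^u$ with $3K\subset I$ and $9|K|<|I|\le18|K|$; otherwise $I^u(K):=\varnothing$. The dyadic Poisson integral is $$Q^u(h\,dw,I):=\sum_{j=0}^\infty\frac{1}{|I^{(j)}|^2}\int_{I^{(j)}}h\,dw .$$ Definition of $\mu_I$. Let $I_0\in\mathscr{D}$ be an initial interval, $n\in\mathbb{N}$; only intervals $I\in\mathscr{D}$ with $I\subseteq I_0$, $|I|>2^{-n}|I_0|$ carry nonzero martingale differences. For $\phi$ locally integrable, $\langle \phi\rangle_I^\sigma:=\sigma(I)^{-1}\int_I\phi\,d\sigma$ (zero if $\sigma(I)=0$), and $\Delta_I^\sigma\phi:=\langle\phi\rangle^\sigma_{I_{\mathrm{left}}}1_{I_{\mathrm{left}}}+\langle\phi\rangle^\sigma_{I_{\mathrm{right}}}1_{I_{\mathrm{right}}}-\langle\phi\rangle_I^\sigma1_I$, with $I_{\mathrm{left}},I_{\mathrm{right}}$ the halves of $I$. Fix $\gamma\in(0,1)$ and $r\in\mathbb{N}$.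 An interval $I\in\mathscr{D}$ is bad if $\mathrm{dist}(I,J^c)\le|I|^\gamma|J|^{1-\gamma}$ for some ancestor $J=I^{(k)}\in\mathscr{D}$ with $k\ge r$ and $|J|\le|I_0|$; otherwise it is good. Let $\mathscr{S}\subseteq\mathscr{D}$ be a collection of stopping intervals with maximal element $I_0$ satisfying the Carleson condition $\sum_{S\in\mathscr{S},S\subseteq J}w(S)\lesssim w(J)$, and let $\pi I:=\min\{S\in\mathscr{S}:S\supseteq I\}$ for $I\in\mathscr{D}$, $I\subseteq I_0$. For $S\in\mathscr{S}$, $\mathscr{K}_S$ is the collection of maximal intervals among the good $I\in\mathscr{D}$ with $\pi(I^{(r)})=S$, and for $K\in\mathscr{K}_S$, $\tilde P^\sigma_{S,K}\phi:=\sum\Delta_I^\sigma\phi$, the sum being over those good $I\subseteq K$ with $|I|>2^{-n}|I_0|$ and $\pi(I^{(r)})=S$. With $\mathrm{id}(x)=x$, $$\mu_I:=\sum_{S\in\mathscr{S}}\ \sum_{K\in\mathscr{K}_S:\ I^u(K)=I}\|\tilde P^\sigma_{S,K}\mathrm{id}\|_{L^2(\sigma)}^2,\qquad I\in\mathscr{D}^u.$$ For $I\in\mathscr{D}^u$, let $W(I):=I\times[\frac12|I|,|I|)$ be the Whitney region, with centre $c(W(I))=(c_I,\frac34|I|)$, where $c_I$ is the centre of $I$. The measure $\mu$ on $\mathbb{R}^2$ is $\mu:=\sum_{I\in\mathscr{D}^u}\mu_I\,\delta_{c(W(I))}$. The Carleson box is $\hat J:=J\times[0,|J|)$, with $|\hat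 J|=|J|^2$; thus $\mu(\hat J)=\sum_{I\in\mathscr{D}^u,I\subseteq J}\mu_I$. Quotients with vanishing denominators $w(J)=0$ or $\mu(\hat J)=0$ are read as $0$. *)

(* Defs.v *)
From HB Require Import structures.
From mathcomp Require Import all_boot all_order all_algebra.
From mathcomp Require Import all_classical all_reals all_analysis.
Import Order.TTheory GRing.Theory Num.Theory.
Import numFieldNormedType.Exports.

Set Implicit Arguments.
Unset Strict Implicit.
Unset Printing Implicit Defensive.

Local Open Scope classical_set_scope.
Local Open Scope ring_scope.

(* (a, b) stands for the half-open interval [a, b); when b <= a this is the
   empty set, but members of dyadic systems have positive length, and on those
   the encoding is injective. *)
Definition hoi (R : realType) : Type := (R * R)%type.

Section Intervals.
Context {R : realType}.
Implicit Types (I J K : hoi R) (E : set (hoi R)) (j k : nat).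

Definition hset I : set R := `[I.1, I.2[%classic.
Definition hempty : hoi R := (0, 0).
Definition hlen I : R := I.2 - I.1.
Definition hmid I : R := (I.1 + I.2) / 2.
Definition hleft I : hoi R := (I.1, hmid I).
Definition hright I : hoi R := (hmid I, I.2).
Definition triple I : hoi R := (I.1 - hlen I, I.2 + hlen I).

(* Intervals of E have lengths c * 2^k; for every k those of length c * 2^k
   cover the line, and nestedness makes them pairwise disjoint. *)
Definition dyadic_system (c : R) E : Prop :=
  [/\ forall I, E I -> exists k : int, hlen I = c * 2 ^ k,
      forall (k : int) (x : R),
        exists I, [/\ E I, hlen I = c * 2 ^ k & hset I x]
    & forall I J, E I -> E J ->
        [\/ hset I `&` hset J = set0, hset I `<=` hset J
          | hset J `<=` hset I]].

Definition tripled_partition (D : set (hoi R)) (Du : 'I_3 -> set (hoi R)) :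
    Prop :=
  [/\ forall u, dyadic_system 3 (Du u),
      \bigcup_u Du u = triple @` D
    & trivIset setT Du].

(* I^(j) within the system E *)
Definition anc E I j : hoi R :=
  xget hempty [set J | [/\ E J, hset I `<=` hset J
                         & hlen J = 2 ^+ j * hlen I]].

(* I^u(K), with E the system D^u *)
Definition Iu E K : hoi R :=
  xget hempty [set I | [/\ E I, hset (triple K) `<=` hset I,
                           9 * hlen K < hlen I & hlen I <= 18 * hlen K]].

Definition set_dist (A B : set R) : R :=
  inf [set `|x - y| | x in A & y in B].

Definition bad D I0 (gamma : R) (r : nat) I : Prop :=
  exists k, [/\ (r <= k)%N, hlen (anc D I k) <= hlen I0
    & set_dist (hset I) (~` hset (anc D I k))
      <= hlen I `^ gamma * hlen (anc D I k) `^ (1 - gamma)].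

(* Carleson box *)
Definition box J : set (measurableTypeR R * measurableTypeR R) :=
  hset J `*` `[0, hlen J[%classic.

(* centre of the Whitney region I x [|I|/2, |I|) *)
Definition whitney_centre I : measurableTypeR R * measurableTypeR R :=
  (hmid I, 3 / 4 * hlen I).

End Intervals.

Section Measures.
Context {R : realType}.
Local Open Scope ereal_scope.
Implicit Types (nu w sigma : {measure set (measurableTypeR R) -> \bar R}).
Implicit Types (I J K S : hoi R) (E D SS : set (hoi R)).

Definition radon nu : Prop :=
  (forall K : set R, compact K -> nu K < +oo) /\
  (forall A : set (measurableTypeR R), measurable A ->
    nu A = ereal_sup [set nu K | K in
                        [set K : set R | compact K /\ K `<=` A]]).

Definition inL2 nu (h : R -> R) : Prop :=
  measurable_fun [set: measurableTypeR R] h /\ finite_norm nu 2%:E h.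

(* The series is valued in \bar R: it is +oo when h >= 0 and it diverges. For
   signed h it may oscillate and then takes a junk value; in a bound required of
   all h in L^2(w) this is harmless, since such an h yields Q(|h|) = +oo. *)
Definition dyadic_poisson E w (h : R -> R) I : \bar R :=
  \sum_(0 <= j <oo) ((hlen (anc E I j) ^- 2)%:E *
                     \int[w]_(x in hset (anc E I j)) (h x)%:E).

(* pi I; equal to hempty, which belongs to no dyadic system, when no member of
   SS contains I *)
Definition stop SS I : hoi R :=
  xget hempty [set S | [/\ SS S, hset I `<=` hset S
    & forall S', SS S' -> hset I `<=` hset S' -> hset S `<=` hset S']].

Definition stopping D w I0 SS : Prop :=
  [/\ SS `<=` D, SS I0, forall S, SS S -> hset S `<=` hset I0
    & exists C : R, forall J, D J ->
        \esum_(S in SS `&` [set S | hset S `<=` hset J]) w (hset S)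
        <= C%:E * w (hset J)].

(* 0^-1 = 0 in R, so this is 0 when sigma(I) = 0 *)
Definition avg sigma I (phi : R -> R) : R :=
  ((fine (sigma (hset I)))^-1 * \int[sigma]_(x in hset I) phi x)%R.

Definition mdiff sigma I (phi : R -> R) (x : R) : R :=
  (avg sigma (hleft I) phi * \1_(hset (hleft I)) x
   + avg sigma (hright I) phi * \1_(hset (hright I)) x
   - avg sigma I phi * \1_(hset I) x)%R.

Section Coefficients.
Variables (sigma : {measure set (measurableTypeR R) -> \bar R}).
Variables (D : set (hoi R)) (I0 : hoi R) (n : nat) (gamma : R) (r : nat).
Variable SS : set (hoi R).

Definition stopped_at S I : Prop :=
  [/\ D I, ~ bad D I0 gamma r I & stop SS (anc D I r) = S].

Definition KS S : set (hoi R) :=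
  [set K | stopped_at S K /\
           forall I, stopped_at S I -> hset K `<=` hset I -> I = K].

Definition Ptilde S K (phi : R -> R) (x : R) : R :=
  (\sum_(I \in [set I | [/\ stopped_at S I, hset I `<=` hset K
                          & 2 ^- n * hlen I0 < hlen I]])
     mdiff sigma I phi x)%R.

Definition mu_coef E I : \bar R :=
  \esum_(S in SS) \esum_(K in KS S `&` [set K | Iu E K = I])
    'N[sigma]_2%:E[EFin \o Ptilde S K id] ^+ 2.

Lemma mu_coef_ge0 E I : 0 <= mu_coef E I.
Proof.
apply: esum_ge0 => S _; apply: esum_ge0 => K _.
exact: mule_ge0 (Lnorm_ge0 _ _ _) (Lnorm_ge0 _ _ _).
Qed.

End Coefficients.

Section WhitneyMeasure.
Context (E : set (hoi R)) (m : hoi R -> \bar R) (m_ge0 : forall I, 0 <= m I).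

Definition whitney_measure & (forall I, 0 <= m I) :=
  fun A : set (measurableTypeR R * measurableTypeR R) =>
  \esum_(I in E) m I * \d_(whitney_centre I) A.

Let whitney0 : whitney_measure m_ge0 set0 = 0.
Proof. by apply: esum1 => I _; rewrite measure0 mule0. Qed.

Let whitney_ge0 A : 0 <= whitney_measure m_ge0 A.
Proof. by apply: esum_ge0 => I _; rewrite mule_ge0. Qed.

Let whitney_sigma_additive : semi_sigma_additive (whitney_measure m_ge0).
Proof.
move=> F mF tF mUF.
rewrite [X in _ --> X](_ : _ =
    lim ((fun n => \sum_(0 <= i < n) whitney_measure m_ge0 (F i)) @ \oo)).
  exact: is_cvg_ereal_nneg_natsum.
rewrite nneseries_esumT// esum_esum; last by move=> *; rewrite mule_ge0.
rewrite (reindex_esum (E `*` setT) _ (fun p => (p.2, p.1))).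
- rewrite -(@esum_esum R _ _ E (fun=> setT)
    (fun I i => m I * \d_(whitney_centre I) (F i))); last first.
    by move=> *; rewrite mule_ge0.
  apply: eq_esum => I _; rewrite -nneseries_esumT; last first.
    by move=> i; rewrite mule_ge0.
  rewrite diracE; have [/set_mem[k _ Fk]|nF] := boolP (_ \in _).
    rewrite mule1 (@nneseriesD1 R _ k)//; last by move=> *; rewrite mule_ge0.
    rewrite diracE mem_set// mule1 eseries0 ?adde0// => i _ /andP[_ ik].
    rewrite diracE memNset ?mule0// => Fi.
    by move/eqP: ik; apply; apply: (tF i k) => //; exists (whitney_centre I).
  rewrite mule0 eseries0// => i _ _; rewrite diracE memNset ?mule0// => Fi.
  by move/negP: nF; apply; apply/mem_set; exists i.
- split => [[I i] [] //|[i1 I1] [i2 I2] _ _ /= [-> ->] //|[i I] [_ /= EI]].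
  by exists (I, i).
Qed.

HB.instance Definition _ := isMeasure.Build _ _ _ (whitney_measure m_ge0)
  whitney0 whitney_ge0 whitney_sigma_additive.

End WhitneyMeasure.

(* a / b, read as 0 when b = 0 *)
Definition quot0 (a b : \bar R) : \bar R := if b == 0 then 0 else a * b^-1.

Section Conditions.
Variables (E : set (hoi R)) (w : {measure set (measurableTypeR R) -> \bar R}).

Definition poisson_bound (m : hoi R -> \bar R) (C : R) : Prop :=
  forall h : R -> R, inL2 w h ->
    \esum_(I in E)
      m I * dyadic_poisson E w (fun x => \1_(~` hset I) x * h x)%R I ^+ 2
    <= (C ^+ 2)%:E * 'N[w]_2%:E[EFin \o h] ^+ 2.

Definition best_constant (m : hoi R -> \bar R) : \bar R :=
  ereal_inf [set C%:E | C in [set C : R | (0 <= C)%R /\ poisson_bound m C]].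

Variable mu :
  {measure set (measurableTypeR R * measurableTypeR R) -> \bar R}.

(* I^(1) \ I *)
Definition sib I : set R := hset (anc E I 1) `\` hset I.

Definition constU : \bar R :=
  ereal_sup [set (hlen J ^- 2)%:E * sqrte (w (sib J)) * sqrte (mu (box J))
            | J in E].

Definition testT J (z : R * R) : \bar R :=
  \esum_(I in E `&` [set I | hset I `<` hset J])
    (\1_(box I) z * hlen I ^- 2)%:E * w (sib I).

Definition constT : \bar R :=
  ereal_sup [set quot0 'N[mu]_2%:E[testT J] (sqrte (w (hset J))) | J in E].

Definition testTstar J (x : R) : \bar R :=
  \esum_(I in E `&` [set I | hset I `<` hset J])
    (\1_(sib I) x)%:E * (mu (box I) * (hlen I ^- 2)%:E).

Definition constTstar : \bar R :=
  ereal_sup [set quot0 'N[w]_2%:E[testTstar J] (sqrte (mu (box J))) | J in E].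

End Conditions.
End Measures.

(* Main.v *)
Require Import Defs.
From HB Require Import structures.
From mathcomp Require Import all_boot all_order all_algebra.
From mathcomp Require Import all_classical all_reals all_analysis.
From mathcomp Require Import measurable_realfun ring lra.
Import Order.TTheory GRing.Theory Num.Theory.
Import numFieldNormedType.Exports HBNNSimple.

(** Write lam_J = |J|^-2, sib J = J^(1) \ J, and E for the dyadic system D^u.
    The set I^(j) \ I is the disjoint union of the sets sib (I^(k)), k < j, and
    lam decreases by a factor 4 from one generation to the next. Hence, for
    h >= 0, the Poisson integral of h 1_(I^c) at I is comparable to the sum of
    lam_J int_(sib J) h dw over all J in E containing I ([poisson_le],
    [poisson_ge]). Since mu puts the mass mu_I at a point which lies in box J
    exactly when I is contained in J, the inequality says, by duality, that
    the bilinear form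

      sum over J in E of  lam_J (int_(sib J) f dw) (int_(box J) g dmu)

    is bounded on L^2(w) x L^2(mu). The numbers U, T and Tstar test this form
    on single terms, on f = 1_J and on g = 1_(box J).

    Necessity is such a test: h is the indicator of sib J for U, that of J for
    T, and a finite partial sum of the function testTstar J for Tstar, the
    latter because its square integral is a part of the form evaluated at h and
    1_(box J).

    Sufficiency is [bilinear_bound], for finitely many J. The sibling of J is
    again an interval of E, called twin J, so the form only depends on the
    averages of f over the intervals twin J and of g over the boxes. For each of
    the two functions choose a family of stopping intervals, along which the
    averages at least double ([stopping_family]); such families satisfy a
    Carleson embedding ([carleson_embedding]). Let j be the smallest stopping
    interval for f that contains twin J, and k the smallest one for g that
    contains J; passing from twin J to j and from J to k costs a factor 2 in
    each average. If j = twin J and k = J, the term is estimated alone, by U.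
    Otherwise j and k are nested. If j is strictly inside k, then k is
    determined by j, and for each k the terms are summed by the testing
    condition Tstar on k; the classes with different j inside the same k do not
    interfere because a sum of squares is at most the square of the sum
    ([testing_bound]). The case where k is strictly inside j is symmetric, with
    T, and the case j = k is treated like the first.

    All estimates have the quadratic shape form <= C K (|f|^2 + |g|^2), with K a
    bound for U, T and Tstar, and are proved by the inequality
    2 x y <= K x^2 + y^2 / K. Choosing for g a small multiple of the image of f
    gives the L^2 bound ([finite_sum_bound]). *)

Set Implicit Arguments.
Unset Strict Implicit.
Unset Printing Implicit Defensive.

Local Open Scope classical_set_scope.
Local Open Scope ring_scope.

(** * Dyadic systems, twins and Carleson boxes *)

Lemma subset_proper {T : Type} (A B C : set T) : A `<=` B -> B `<` C -> A `<` C.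
Proof.
move=> AB [BC CB]; split; first exact: subset_trans AB BC.
by move=> CA; apply: CB; exact: subset_trans CA AB.
Qed.

Section DyadicGeometry.
Context {R : realType}.
Implicit Types (I J K : hoi R) (x : R).

Lemma hsetP I x : hset I x <-> I.1 <= x /\ x < I.2.
Proof. by rewrite /hset/= in_itv/=; split => [/andP[]|[-> ->]]. Qed.

Lemma hset_left I : 0 < hlen I -> hset I I.1.
Proof. by rewrite /hlen => I0; apply/hsetP; split => //; lra. Qed.

Lemma hset_subP I J : 0 < hlen I ->
  hset I `<=` hset J <-> J.1 <= I.1 /\ I.2 <= J.2.
Proof.
rewrite /hlen => I0; split=> [IJ|[a b] x /hsetP[? ?]]; last first.
  by apply/hsetP; split; lra.
have /hsetP[a b] := IJ _ (hset_left I0); split => //.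
rewrite leNgt; apply/negP => h.
suff: hset J J.2 by move/hsetP => [_]; rewrite ltxx.
by apply: IJ; apply/hsetP; split; lra.
Qed.

Lemma hlen_le I J : 0 < hlen I -> hset I `<=` hset J -> hlen I <= hlen J.
Proof. by move=> I0 /(hset_subP _ I0)[]; rewrite /hlen => ? ?; lra. Qed.

Lemma hset_eq I J : 0 < hlen I -> hset I `<=` hset J -> hlen J <= hlen I ->
  I = J.
Proof.
case: I J => [a b] [a' b'] I0 /(hset_subP _ I0)[]; rewrite /hlen/= => ? ? ?.
by congr pair; lra.
Qed.

Context {c : R} (c0 : 0 < c) {E : set (hoi R)} (dE : dyadic_system c E).

Lemma hlen_gt0 I : E I -> 0 < hlen I.
Proof. by case: dE => h _ _ /h[k ->]; rewrite mulr_gt0// exprz_gt0. Qed.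

Lemma nested I J x : E I -> E J -> hset I x -> hset J x -> hlen I <= hlen J ->
  hset I `<=` hset J.
Proof.
move=> EI EJ Ix Jx IJ; case: dE => _ _ /(_ I J EI EJ)[|//|JI].
  by move=> /seteqP[/(_ x)]; case.
by rewrite (@hset_eq J I) => //; apply: hlen_gt0.
Qed.

Lemma eq_len_meet I J x : E I -> E J -> hset I x -> hset J x ->
  hlen I = hlen J -> I = J.
Proof.
move=> EI EJ Ix Jx IJ; apply: hset_eq (hlen_gt0 EI) _ _; last by rewrite IJ.
by apply: nested Ix Jx _ => //; rewrite IJ.
Qed.

Lemma hset_inj I J : E I -> E J -> hset I = hset J -> I = J.
Proof.
move=> EI EJ IJ; apply: hset_eq (hlen_gt0 EI) _ _; first by rewrite IJ.
by apply: hlen_le (hlen_gt0 EJ) _; rewrite IJ.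
Qed.

Lemma ancP I j : E I ->
  [/\ E (anc E I j), hset I `<=` hset (anc E I j)
    & hlen (anc E I j) = 2 ^+ j * hlen I].
Proof.
move=> EI; rewrite /anc; case: xgetP => [J _ //|].
case: (dE) => /(_ I EI)[k Ik] cov _.
have [J [EJ Jk JI]] := cov (j%:Z + k) I.1.
move=> /(_ J); case; split => //; last first.
  by rewrite Jk Ik expfzDr// mulrCA.
apply: nested (hset_left (hlen_gt0 EI)) JI _ => //.
rewrite Jk Ik expfzDr// [c * (_ * _)]mulrCA -exprnP ler_peMl//.
  by rewrite mulr_ge0 ?exprz_ge0 ?ltW.
by rewrite exprn_ege1// ler1n.
Qed.

Lemma anc_in I j : E I -> E (anc E I j).
Proof. by move/(ancP j) => []. Qed.

Lemma anc_sub I j : E I -> hset I `<=` hset (anc E I j).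
Proof. by move/(ancP j) => []. Qed.

Lemma hlen_anc I j : E I -> hlen (anc E I j) = 2 ^+ j * hlen I.
Proof. by move/(ancP j) => []. Qed.

Lemma anc_uniq I J j : E I -> E J -> hset I `<=` hset J ->
  hlen J = 2 ^+ j * hlen I -> anc E I j = J.
Proof.
move=> EI EJ IJ h; have [EA IA lA] := ancP j EI.
have Il := hset_left (hlen_gt0 EI).
by apply: eq_len_meet (IA _ Il) (IJ _ Il) _ => //; rewrite lA h.
Qed.

Lemma anc0 I : E I -> anc E I 0 = I.
Proof. by move=> EI; apply: anc_uniq => //; rewrite expr0 mul1r. Qed.

Lemma ancS I j : E I -> anc E I j.+1 = anc E (anc E I j) 1.
Proof.
move=> EI; have EA := anc_in j EI; apply: anc_uniq => //.
- exact: anc_in.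
- by apply: subset_trans (anc_sub 1 EA); exact: anc_sub.
- by rewrite !hlen_anc// mulrA -exprD add1n.
Qed.

Lemma anc_inj I i j : E I -> anc E I i = anc E I j -> i = j.
Proof.
move=> EI /(congr1 (@hlen R)); rewrite !hlen_anc//.
move=> /(mulIf (lt0r_neq0 (hlen_gt0 EI))) h.
by apply: ieexprIn h => //; rewrite gt_eqF// ltr1n.
Qed.

Lemma anc_le I i j : E I -> (i <= j)%N ->
  hset (anc E I i) `<=` hset (anc E I j).
Proof.
move=> EI /subnKC <-; elim: (j - i)%N => [|k ih]; first by rewrite addn0.
by rewrite addnS ancS//; apply: subset_trans ih _; apply/anc_sub/anc_in.
Qed.

Lemma sub_anc I J : E I -> E J -> hset I `<=` hset J -> exists j, J = anc E I j.
Proof.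
move=> EI EJ IJ; case: (dE) => len _ _.
have [k Ik] := len _ EI; have [l Jl] := len _ EJ.
have kl : k <= l.
  have := hlen_le (hlen_gt0 EI) IJ; rewrite Ik Jl ler_pM2l//.
  by rewrite ler_eXz2l// ltr1n.
exists `|l - k|%N; apply/esym/anc_uniq => //.
have -> : 2 ^+ `|l - k| =
  2 ^ (l - k) :> R by rewrite exprnP gez0_abs// subr_ge0.
by rewrite Ik Jl mulrCA -expfzDr// subrK.
Qed.

Lemma proper_anc I J : E I -> E J -> hset I `<` hset J ->
  hset (anc E I 1) `<=` hset J.
Proof.
move=> EI EJ; rewrite properEneq => -[/eqP IJ sIJ].
have [[|j] J_] := sub_anc EI EJ sIJ; rewrite J_; last exact: anc_le.
by case: IJ; rewrite J_ anc0.
Qed.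

(** An interval of the length of I that contains a point of the parent outside
    of I lies in the parent and is disjoint from I. As the parent has only twice
    the length of I, this leaves room for I only as one of its halves, and the
    other half is a member of the system. *)
Lemma sib_ex I : E I ->
  exists K, [/\ E K, hset K = sib E I, hlen K = hlen I,
    anc E K 1 = anc E I 1 & sib E K = hset I].
Proof.
move=> EI; have [EP IP] := ancP 1 EI.
have I0 := hlen_gt0 EI; have P0 := hlen_gt0 EP.
rewrite expr1 => lP.
have [h1 h2] := (hset_subP _ I0).1 IP.
case: (dE) => len cov _; have [k Ik] := len _ EI.
have fin K x : E K -> hlen K = hlen I -> hset (anc E I 1) x -> hset K x ->
    ~ hset I x -> hset K = sib E I ->
    [/\ E K, hset K = sib E I, hlen K = hlen I,
    anc E K 1 = anc E I 1 & sib E K = hset I].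
  move=> EK lK Px Kx nIx KI.
  have aK : anc E K 1 = anc E I 1.
    apply: anc_uniq => //; last by rewrite expr1 lK.
    by rewrite KI; move=> y [].
  split => //; rewrite /sib aK KI /sib setDD.
  by apply/setIidPr.
have side K x : E K -> hlen K = c * 2 ^ k -> hset (anc E I 1) x -> hset K x ->
    ~ hset I x -> (anc E I 1).1 <= K.1 /\ K.2 <= (anc E I 1).2
      /\ (K.2 <= I.1 \/ I.2 <= K.1).
  move=> EK lK Px Kx nIx; have K0 := hlen_gt0 EK.
  have /(hset_subP _ K0)[? ?] : hset K `<=` hset (anc E I 1).
    by apply: nested Kx Px _ => //; rewrite lP lK -Ik; lra.
  split => //; split => //.
  case: (leP K.2 I.1) => [|a]; [by left|right].
  rewrite leNgt; apply/negP => b; apply: nIx.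
  suff -> : I = K by [].
  case: (leP I.1 K.1) => d.
    by apply: (@eq_len_meet _ _ K.1) => //; rewrite ?lK//;
      [apply/hsetP|apply: hset_left].
  by apply: (@eq_len_meet _ _ I.1) => //; rewrite ?lK//;
      [apply: hset_left|apply/hsetP; split => //; lra].
case: (ltP (anc E I 1).1 I.1) => a.
  have [K [EK lK Kx]] := cov k (anc E I 1).1.
  have Px := hset_left P0.
  have nI : ~ hset I (anc E I 1).1 by move/hsetP => [] ? ?; lra.
  have [s1 [s2 s3]] := side _ _ EK lK Px Kx nI.
  exists K; apply: (fin K _ EK _ Px Kx nI); first by rewrite lK.
  move: lK; rewrite -Ik => lK.
  have /hsetP[? ?] := Kx.
  rewrite /hlen in lP lK I0.
  have {s3}s3 : K.2 <= I.1 by case: s3 => //; lra.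
  have e1 : (anc E I 1).1 = K.1 by lra.
  have e2 : K.2 = I.1 by lra.
  have e3 : I.2 = (anc E I 1).2 by lra.
  apply/seteqP; split=> x.
    by move/hsetP => [? ?]; split; [apply/hsetP; split|move/hsetP => []]; lra.
  move=> [/hsetP[? ?] nIx]; apply/hsetP; split; first lra.
  rewrite ltNge; apply/negP => ?; apply: nIx; apply/hsetP; split; lra.
have [K [EK lK Kx]] := cov k I.2.
have Px : hset (anc E I 1) I.2.
  by apply/hsetP; rewrite /hlen in lP I0; split; lra.
have nI : ~ hset I I.2 by move/hsetP => [] ? ?; lra.
have [s1 [s2 s3]] := side _ _ EK lK Px Kx nI.
exists K; apply: (fin K _ EK _ Px Kx nI); first by rewrite lK.
move: lK; rewrite -Ik => lK.
have /hsetP[? ?] := Kx.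
rewrite /hlen in lP lK I0.
have {s3}s3 : I.2 <= K.1 by case: s3 => //; lra.
apply/seteqP; split=> x.
  by move/hsetP => [? ?]; split; [apply/hsetP; split|move/hsetP => []]; lra.
move=> [/hsetP[? ?] nIx]; apply/hsetP; split; last lra.
rewrite leNgt; apply/negP => ?; apply: nIx; apply/hsetP; split; lra.
Qed.

End DyadicGeometry.

Section TwinBoxes.
Context {R : realType}.
Implicit Types (I J K : hoi R) (x : R) (z : R * R).

Lemma measurable_hset I : measurable (hset I : set (measurableTypeR R)).
Proof. exact: measurable_itv. Qed.

Lemma measurable_box I : measurable (box I).
Proof.
by apply: measurableX; [exact: measurable_hset|exact: measurable_itv].
Qed.

Lemma measurable_sib (E : set (hoi R)) I :
  measurable (sib E I : set (measurableTypeR R)).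
Proof. by apply: measurableD; exact: measurable_hset. Qed.

(** The sibling of I as an interval, which exists by [sib_ex]; f is averaged
    over these intervals. *)
Definition twin (E : set (hoi R)) I : hoi R :=
  xget hempty [set K | E K /\ hset K = sib E I].

Context {c : R} (c0 : 0 < c) {E : set (hoi R)} (dE : dyadic_system c E).

Lemma twinP I : E I ->
  [/\ E (twin E I), hset (twin E I) = sib E I, hlen (twin E I) = hlen I,
    anc E (twin E I) 1 = anc E I 1 & sib E (twin E I) = hset I].
Proof.
move=> EI; have [K [EK KI lK aK sK]] := sib_ex c0 dE EI.
suff -> : twin E I = K by [].
rewrite /twin; case: xgetP => [K' _ [EK' K'I]|/(_ K)/=]; last by case.
by apply: (hset_inj c0 dE) => //; rewrite K'I KI.
Qed.

Lemma twinK I : E I -> twin E (twin E I) = I.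
Proof.
move=> EI; have [EK KI lK aK sK] := twinP EI.
have [EK' + _ _ _] := twinP EK; rewrite sK.
exact: (hset_inj c0 dE).
Qed.

Lemma twin_in I : E I -> E (twin E I). Proof. by move/twinP => []. Qed.

Lemma hset_twin I : E I -> hset (twin E I) = sib E I.
Proof. by move/twinP => []. Qed.

Lemma sib_sub I J : E I -> E J -> hset I `<` hset J -> sib E I `<=` hset J.
Proof.
by move=> EI EJ IJ; apply: subset_trans (proper_anc c0 dE EI EJ IJ);
  apply: subIsetl.
Qed.

(** In a dyadic system an interval strictly larger than twin I contains the
    common parent of twin I and I. *)
Lemma proper_twin I J : E I -> E J -> hset (twin E I) `<=` hset J ->
  J <> twin E I -> hset I `<` hset J.
Proof.
move=> EI EJ tJ nJ; have [EK KI lK aK sK] := twinP EI.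
have /(proper_anc c0 dE EK EJ) : hset (twin E I) `<` hset J.
  by rewrite properEneq; split => //; apply/eqP => /(hset_inj c0 dE EK EJ)/esym.
rewrite aK => PJ; rewrite properEneq; split; last first.
  by apply: subset_trans PJ; exact: (anc_sub c0 dE).
apply/eqP => IJ.
have [_ /(_ _ (hset_left (hlen_gt0 c0 dE EK)))] := (IJ, tJ).
rewrite -IJ; have := hset_left (hlen_gt0 c0 dE EK); rewrite KI => -[]//.
Qed.

Lemma box_sub I J : 0 < hlen I -> hset I `<=` hset J -> box I `<=` box J.
Proof.
move=> I0 IJ z [z1]; rewrite /= in_itv/= => /andP[z20 z2]; split;
  first exact: IJ.
by rewrite /= in_itv/= z20 (lt_le_trans z2)// hlen_le.
Qed.

Lemma box_nested I J z : E I -> E J -> box I z -> box J z -> hlen I <= hlen J ->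
  hset I `<=` hset J.
Proof. by move=> EI EJ [Iz _] [Jz _]; exact: (nested c0 dE EI EJ Iz Jz). Qed.

Lemma hmid_in I : 0 < hlen I -> hset I (hmid I).
Proof. by rewrite /hlen /hmid => ?; apply/hsetP; split; lra. Qed.

(** The centre is at the height 3/4 |I|. Lengths in E differ by powers of 2, so
    3/4 |I| < |J| is only possible if |I| <= |J|. *)
Lemma box_whitney I J : E I -> E J ->
  box J (whitney_centre I) <-> hset I `<=` hset J.
Proof.
move=> EI EJ; have I0 := hlen_gt0 c0 dE EI; have J0 := hlen_gt0 c0 dE EJ.
split=> [[/= mJ]|IJ].
  rewrite in_itv/= => /andP[_ IJ]; have [lIJ|lJI] := leP (hlen I) (hlen J).
    exact: (nested c0 dE EI EJ (hmid_in I0) mJ).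
  have JI := nested c0 dE EJ EI mJ (hmid_in I0) (ltW lJI).
  have [[|j] I_] := sub_anc c0 dE EJ EI JI.
    by move: lJI; rewrite I_ (anc0 c0 dE)// ltxx.
  move: IJ; rewrite {1}I_ (hlen_anc c0 dE)// exprS.
  have : 1 <= (2 : R) ^+ j by rewrite exprn_ege1// ler1n.
  nra.
split; first exact/IJ/hmid_in.
rewrite /= in_itv/=; have := hlen_le I0 IJ; move: I0.
by move=> ? ?; apply/andP; split; lra.
Qed.

Lemma whitney_centre_inj I J : whitney_centre I = whitney_centre J -> I = J.
Proof.
case: I J => [a b] [a' b']; rewrite /whitney_centre/hmid/hlen/= => -[? ?].
by congr pair; lra.
Qed.

End TwinBoxes.

(** * Finite and unordered sums *)

(** When the values double at each step, the ones below the largest value sum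
    to at most that value, so the sum squared is comparable to its largest
    term squared. *)
Lemma sum_doubling_le {R : realFieldType} {I : eqType} (s : seq I)
    (v : I -> R) :
  uniq s -> (forall i, 0 <= v i) ->
  {in s &, forall i j, i != j -> 2 * v i <= v j \/ 2 * v j <= v i} ->
  (\sum_(i <- s) v i) ^+ 2 <= 3 * \sum_(i <- s) v i ^+ 2.
Proof.
move=> us v0 dbl; pose r i j := v j <= v i.
have rT : total r by move=> i j; rewrite /r le_total.
have ss : sorted r (sort r s) := sort_sorted rT s.
have us' : uniq (sort r s) by rewrite sort_uniq.
have {}dbl : {in sort r s &, forall i j, i != j -> 2 * v i <= v j \/ 2 * v j <=
  v i}.
  by move=> i j; rewrite !mem_sort; exact: dbl.
have pr : perm_eq s (sort r s) by rewrite perm_sym; apply/permPl/perm_sort.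
rewrite !(perm_big _ pr)/=.
have rt : transitive r by move=> j i k ij jk; exact: le_trans jk ij.
suff : (forall M, (forall i, i \in sort r s -> v i <= M) -> 0 <= M ->
    \sum_(i <- sort r s) v i <= 2 * M) /\
  (\sum_(i <- sort r s) v i) ^+ 2 <= 3 * \sum_(i <- sort r s) v i ^+ 2 by case.
move: (sort r s) ss us' dbl => {s us pr}; elim=> [|i s ih].
  by rewrite !big_nil => _ _ _; split; [move=> M _ ?|]; lra.
rewrite /= path_sortedE// => /andP[/allP mi ss] /andP[nis us] dbl.
have [|ih1 ih2] := ih ss us.
  by move=> j k js ks; apply: dbl; rewrite inE (js, ks) orbT.
have half j : j \in s -> v j <= v i / 2.
  move=> js; have ij : i != j by apply: contraNneq nis => ->.
  have ji := mi _ js; rewrite /r in ji.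
  have js' : j \in i :: s by rewrite inE js orbT.
  by case: (dbl i j (mem_head _ _) js' ij); have := v0 j; lra.
have rest : \sum_(j <- s) v j <= v i.
  by have := ih1 _ half; have := v0 i; lra.
have rest0 : 0 <= \sum_(j <- s) v j by apply: sumr_ge0.
rewrite !big_cons; split=> [M hM M0|].
  by have := hM i (mem_head _ _); lra.
have : (\sum_(j <- s) v j) * v i <= v i * v i by rewrite ler_wpM2r.
by nra.
Qed.

Lemma sum_if_eq {R : nmodType} {J : eqType} (s : seq J) (k0 : J) (F : J -> R) :
  uniq s -> k0 \in s -> \sum_(k <- s) (if k0 == k then F k else 0) = F k0.
Proof.
move=> us ks; rewrite (bigD1_seq k0)//= eqxx big1 ?addr0// => k.
by rewrite eq_sym => /negbTE ->.
Qed.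

Section Fibers.
Context {R : realFieldType} {I J : eqType} (X : seq I) (s : seq J) (j : I -> J).
Hypotheses (us : uniq s) (js : {in X, forall i, j i \in s}).
Implicit Type psi : I -> R.

Lemma sum_fibers psi :
  \sum_(i <- X) psi i = \sum_(k <- s) \sum_(i <- X | j i == k) psi i.
Proof.
under [RHS]eq_bigr do rewrite big_mkcond/=.
rewrite exchange_big/=; apply: eq_big_seq => i iX.
by rewrite (@sum_if_eq _ _ s (j i) (fun=> psi i))// js.
Qed.

(** In this form sums of squares over two families of fibres can be compared:
    passing to larger fibres adds nonnegative products. *)
Lemma sum_sqr_fibers psi :
  \sum_(k <- s) (\sum_(i <- X | j i == k) psi i) ^+ 2 =
  \sum_(i <- X) \sum_(i' <- X | j i' == j i) psi i * psi i'.
Proof.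
under eq_bigr do rewrite expr2 big_distrlr big_mkcond/=.
rewrite exchange_big/=; apply: eq_big_seq => i iX.
by rewrite (@sum_if_eq _ _ s (j i) (fun k => \sum_(i' <- X | j i' == k) _))//
  js.
Qed.

End Fibers.

Section UnorderedSums.
Context {R : realType}.
Local Open Scope ereal_scope.

Lemma sum_le_esum {I : choiceType} (s : seq I) (P : pred I) (S : set I)
    (a : I -> \bar R) : uniq s -> (forall i, 0 <= a i) ->
  (forall i, i \in s -> P i -> S i) ->
  \sum_(i <- s | P i) a i <= \esum_(i in S) a i.
Proof.
move=> us a0 sS; rewrite -big_filter; set t := [seq i <- s | P i].
apply: esum_ge; exists [set` t].
  split; first exact: finite_seq.
  by move=> i/=; rewrite mem_filter => /andP[/[swap]]; exact: sS.
by rewrite (fsbig_seq _ _ (filter_uniq _ us)).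
Qed.

Lemma sum_le_subset {I : eqType} (s t : seq I) (a : I -> \bar R) :
  uniq s -> uniq t -> {subset s <= t} -> (forall i, 0 <= a i) ->
  \sum_(i <- s) a i <= \sum_(i <- t) a i.
Proof.
move=> us ut st a0; have p : perm_eq s [seq i <- t | i \in s].
  apply: uniq_perm => //; first exact: filter_uniq.
  by move=> i; rewrite mem_filter; case: (boolP (i \in s)) => //= /st ->.
rewrite (perm_big _ p)/= big_filter [leRHS](bigID (mem s))/= leeDl//.
by apply: sume_ge0.
Qed.

Lemma esumZl_le {T : choiceType} (S : set T) (a : T -> \bar R) (x : R) :
  (0 <= x)%R -> (forall i, 0 <= a i) ->
  x%:E * (\esum_(i in S) a i) <= \esum_(i in S) (x%:E * a i).
Proof.
move=> x0 a0; have xa i : 0 <= x%:E * a i by rewrite mule_ge0.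
case: (ltgtP x 0%R) x0 => // [x0 _|-> _];
  last by rewrite mul0e esum_ge0// => i _; rewrite mul0e.
rewrite -lee_pdivlMl//; apply: ge_ereal_sup => _ [B [fB BS] <-].
rewrite lee_pdivlMl// fsbig_finite//= ge0_sume_distrr//.
by apply: esum_ge; exists B => //; rewrite fsbig_finite.
Qed.

Lemma lee_sum_mul_sqr {I : eqType} (s : seq I) (a q u : I -> \bar R) :
  (forall i, 0 <= a i) -> (forall i, 0 <= q i) ->
    {in s, forall i, q i <= u i} ->
  \sum_(i <- s) a i * q i ^+ 2 <= \sum_(i <- s) a i * u i ^+ 2.
Proof.
move=> a0 q0 qu; rewrite big_seq [leRHS]big_seq; apply: lee_sum => i si.
by rewrite lee_wpmul2l// lee_sqr ?qu// (le_trans (q0 i))// qu.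
Qed.

Lemma lee_mul_sqr (a x y : \bar R) : (y < +oo -> x ^+ 2 <= y ^+ 2) ->
  0 <= a -> a * y ^+ 2 < +oo -> a * x ^+ 2 <= a * y ^+ 2.
Proof.
move=> xy; rewrite le_eqVlt => /orP[/eqP <- _|a0]; first by rewrite !mul0e.
move=> ayoo; apply: lee_wpmul2l; first exact: ltW.
apply: xy; move: ayoo.
rewrite !ltey; apply: contra_neq => ->.
by rewrite expe2 mulyy gt0_muley.
Qed.

Lemma le_esumZl {T : choiceType} (S : set T) (a : T -> \bar R) (x : R) :
  (0 <= x)%R -> (forall i, 0 <= a i) ->
  \esum_(i in S) (x%:E * a i) <= x%:E * (\esum_(i in S) a i).
Proof.
move=> x0 a0; apply: ge_ereal_sup => _ [B [fB BS] <-].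
rewrite fsbig_finite//= -ge0_sume_distrr// lee_wpmul2l ?lee_fin//.
by apply: esum_ge; exists B => //; rewrite fsbig_finite.
Qed.

End UnorderedSums.

(** * Integrals of nonnegative functions *)

Section Integrals.
Local Open Scope ereal_scope.
Context {R : realType} d (T : measurableType d)
  (nu : {measure set T -> \bar R}).

(** The integral of a nonnegative function is the supremum of the integrals of
    the simple functions below it, hence monotone also for the unordered sums
    testT and testTstar, whose measurability is not obvious. *)
Lemma le_integral_ge0 (f1 f2 : T -> \bar R) :
  (forall x, 0 <= f1 x) -> (forall x, f1 x <= f2 x) ->
  \int[nu]_x f1 x <= \int[nu]_x f2 x.
Proof.
move=> f10 f12; have f20 x := le_trans (f10 x) (f12 x).
rewrite !ge0_integralTE//; apply: ereal_sup_le => _ [h hf <-].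
by exists h => // x; apply: le_trans (hf x) _.
Qed.

Lemma integral_simple {I : Type} (s : seq I) (a : I -> R) (B : I -> set T) :
  (forall i, (0 <= a i)%R) -> (forall i, measurable (B i)) ->
  \int[nu]_x (\sum_(i <- s) a i * \1_(B i) x)%:E =
  \sum_(i <- s) (a i)%:E * nu (B i).
Proof.
move=> a0 mB; under eq_integral do rewrite -sumEFin.
rewrite ge0_integral_sum//; last 2 first.
- by move=> i; apply/measurable_EFinP; apply: measurable_funM.
- by move=> i x _; rewrite lee_fin mulr_ge0.
- apply: eq_bigr => i _; under eq_integral do rewrite EFinM.
  rewrite ge0_integralZl_EFin//;
    last by apply/measurable_EFinP/measurable_indic.
  by rewrite integral_indic// setIT.
Qed.

Lemma measurable_simple {I : Type} (s : seq I) (P : pred I) (a : I -> R)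
  (B : I -> set T) : (forall i, measurable (B i)) ->
  measurable_fun setT (fun x => \sum_(i <- s | P i) a i * \1_(B i) x)%R.
Proof.
move=> mB; under eq_fun do rewrite big_mkcond.
apply: measurable_sum => i; case: (P i) => //.
by apply: measurable_funM => //.
Qed.

End Integrals.

Section SquareIntegrable.
Context {R : realType}.
Local Open Scope ereal_scope.

Lemma Lnorm2E d (T : measurableType d) (nu : {measure set T -> \bar R})
  (f : T -> \bar R) : 'N[nu]_2%:E[f] ^+ 2 = \int[nu]_x (f x ^+ 2).
Proof.
have sq (x : \bar R) : 0 <= x -> x `^ 2 = x ^+ 2.
  case: x => [r r0||]//=.
  - by rewrite powR_mulrn.
  - by move=> _; rewrite /poweR pnatr_eq0.
rewrite -sq ?Lnorm_ge0// poweR_Lnorm; last by rewrite pnatr_eq0.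
apply: eq_integral => x _; rewrite sq//.
by case: (f x) => [r||]//=; rewrite -EFinM -normrM ger0_norm// sqr_ge0.
Qed.

Lemma indicator_sqr (A : set R) x : (\1_A x ^+ 2 = \1_A x :> R)%R.
Proof. by rewrite indicE; case: (_ \in _); rewrite ?expr1n ?expr0n. Qed.

Section Mean.
Context d (T : measurableType d) (nu : {measure set T -> \bar R}).

Definition mean (f : T -> R) (A : set T) : R :=
  (fine (\int[nu]_(x in A) (f x)%:E) / fine (nu A))%R.

Lemma mean_ge0 (f : T -> R) A : (forall x, 0 <= f x)%R -> (0 <= mean f A)%R.
Proof.
move=> f0; rewrite divr_ge0// fine_ge0//.
by apply: integral_ge0 => x _; rewrite lee_fin.
Qed.

(** On A one has f <= 1 + f ^ 2. *)
Lemma integral_L2_lty (f : T -> R) A : measurable A -> measurable_fun setT f ->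
  (forall x, 0 <= f x)%R -> nu A < +oo -> \int[nu]_x (f x ^+ 2)%:E < +oo ->
  \int[nu]_(x in A) (f x)%:E < +oo.
Proof.
move=> mA mf f0 fA ff.
apply: (@le_lt_trans _ _ (\int[nu]_x ((\1_A x)%:E + (f x ^+ 2)%:E))).
  rewrite integral_mkcond; apply: le_integral_ge0 => x; rewrite patchE.
    by case: ifP => _; rewrite ?lee_fin.
  rewrite indicE; case: ifP => _;
    last by rewrite -EFinD lee_fin/= add0r sqr_ge0.
  by rewrite -EFinD lee_fin/=; have := sqr_ge0 (f x - 2^-1)%R; nra.
rewrite ge0_integralD//; first last.
- by apply/measurable_EFinP; exact: measurable_funX.
- by move=> x _; rewrite lee_fin sqr_ge0.
- by apply/measurable_EFinP/measurable_indic.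
by rewrite integral_indic// setIT lte_add_pinfty.
Qed.

Lemma meanE (f : T -> R) A : measurable A -> measurable_fun setT f ->
  (forall x, 0 <= f x)%R -> 0 < nu A -> nu A < +oo ->
  \int[nu]_x (f x ^+ 2)%:E < +oo ->
  \int[nu]_(x in A) (f x)%:E = (mean f A)%:E * nu A.
Proof.
move=> mA mf f0 A0 Aoo foo; rewrite /mean -[X in _ * X]fineK; last first.
  by rewrite ge0_fin_numE.
rewrite -EFinM divfK; last by rewrite gt_eqF// fine_gt0// A0.
rewrite fineK// ge0_fin_numE; first exact: integral_L2_lty.
by apply: integral_ge0 => x _; rewrite lee_fin.
Qed.

End Mean.

End SquareIntegrable.

(** * The Carleson embedding and the testing estimate *)

Section Embedding.
Local Open Scope ereal_scope.
Context {R : realType} d (T : measurableType d)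
  (nu : {measure set T -> \bar R}).

Lemma sum_fin_num {I : eqType} (s : seq I) (a : I -> R) (B : I -> set T) :
  {in s, forall i, nu (B i) < +oo} ->
  \sum_(i <- s) (a i)%:E * nu (B i) \is a fin_num.
Proof.
move=> fB; rewrite big_seq_cond; apply/sum_fin_numP => i _; rewrite andbT => si.
by rewrite fin_numM// ge0_fin_numE// fB.
Qed.

(** Let S be the sum of the functions v_i 1_(B_i). The left side is the integral
    of f S. Pointwise f S <= 3/2 f^2 + S^2 / 6, and S^2 is at most three times
    the sum of the v_i^2 1_(B_i) by [sum_doubling_le]; so the contribution of
    S^2 is at most half of the left side, which is finite and absorbs it. *)
Lemma carleson_embedding {I : eqType} (s : seq I) (B : I -> set T) (v : I -> R)
    (f : T -> R) :
  uniq s -> (forall i, measurable (B i)) -> measurable_fun setT f ->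
  (forall x, 0 <= f x)%R -> (forall i, 0 <= v i)%R ->
  {in s, forall i, nu (B i) < +oo} ->
  {in s, forall i, \int[nu]_(x in B i) (f x)%:E = (v i)%:E * nu (B i)} ->
  {in s &, forall i j, i != j -> forall x, B i x -> B j x ->
    (2 * v i <= v j \/ 2 * v j <= v i)%R} ->
  \sum_(i <- s) (v i ^+ 2)%:E * nu (B i) <= 3%:E * \int[nu]_x (f x ^+ 2)%:E.
Proof.
move=> us mB mf f0 v0 fB fv dbl.
set Q := \sum_(i <- s) _.
have Qfin : Q \is a fin_num by exact: sum_fin_num.
have fS x : (f x * (\sum_(i <- s) v i * \1_(B i) x) <=
    3 / 2 * f x ^+ 2 + \sum_(i <- s) (v i ^+ 2 / 2) * \1_(B i) x)%R.
  set S := (\sum_(i <- s) v i * _)%R.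
  have : (S ^+ 2 <= 3 * \sum_(i <- s) (v i * \1_(B i) x) ^+ 2)%R.
    rewrite /S; have -> (F : I -> R) :
        (\sum_(i <- s) F i = \sum_(i <- s) if i \in s then F i else 0)%R.
      by apply: eq_big_seq => i ->.
    have -> (F : I -> R) : (\sum_(i <- s) (F i) ^+ 2 =
        \sum_(i <- s) (if i \in s then F i else 0) ^+ 2)%R.
      by apply: eq_big_seq => i ->.
    apply: sum_doubling_le => // [i|i j si sj ij].
      by case: ifP => // _; rewrite mulr_ge0.
    rewrite si sj !indicE; have := dbl i j si sj ij x.
    case: (boolP (x \in B i)) => [/set_mem Bi|_]; last first.
      by left; rewrite mulr0 mulr0 mulr_ge0.
    case: (boolP (x \in B j)) => [/set_mem Bj|_]; last first.
      by right; rewrite mulr0 mulr0 mulr_ge0.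
    by rewrite !mulr1; exact.
  have -> : (\sum_(i <- s) (v i * \1_(B i) x) ^+ 2 =
      2 * \sum_(i <- s) v i ^+ 2 / 2 * \1_(B i) x)%R.
    rewrite mulr_sumr; apply: eq_bigr => i _; rewrite indicE.
    by case: (_ \in _); rewrite ?mulr1 ?mulr0 ?expr0n//= mulrC divfK.
  set W := (\sum_(i <- s) _ / 2 * _)%R => hS.
  have := sqr_ge0 (3 * f x - S)%R; nra.
have Qint : Q = \int[nu]_x (f x * (\sum_(i <- s) v i * \1_(B i) x))%:E.
  under eq_integral do rewrite mulr_sumr -sumEFin.
  rewrite ge0_integral_sum//; last 2 first.
  - move=> i; apply/measurable_EFinP; do 2 apply: measurable_funM => //.
  - by move=> i x _; rewrite lee_fin !mulr_ge0.
  apply: eq_big_seq => i si.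
  have -> : (v i ^+ 2)%:E * nu (B i) = (v i)%:E * \int[nu]_(x in B i) (f x)%:E.
    by rewrite fv// muleA -EFinM -expr2.
  rewrite integral_mkcond -ge0_integralZl_EFin//.
  - apply: eq_integral => x _; rewrite patchE indicE.
    by case: (x \in B i); rewrite ?mulr1 ?mulr0 ?mule0// -EFinM mulrC.
  - by move=> x _; rewrite patchE; case: ifP; rewrite ?lee_fin.
  - apply/(measurable_restrictT _ _).1 => //; apply/measurable_EFinP.
    exact: measurable_funTS.
have : Q <= (3 / 2)%:E * \int[nu]_x (f x ^+ 2)%:E + (2^-1)%:E * Q.
  rewrite [leLHS]Qint; apply: (@le_trans _ _ (\int[nu]_x
    ((3 / 2 * f x ^+ 2)%:E + (\sum_(i <- s) (v i ^+ 2 / 2) * \1_(B i) x)%:E))).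
    apply: le_integral_ge0 => x; last by rewrite -EFinD lee_fin.
    by rewrite lee_fin mulr_ge0// sumr_ge0// => i _; rewrite mulr_ge0.
  rewrite ge0_integralD//; first last.
  - by apply/measurable_EFinP; apply: measurable_simple.
  - by move=> x _; rewrite lee_fin sumr_ge0// => i _;
      rewrite mulr_ge0// divr_ge0// sqr_ge0.
  - by apply/measurable_EFinP; apply: measurable_funM => //;
      exact: measurable_funX.
  - by move=> x _; rewrite lee_fin mulr_ge0// sqr_ge0.
  rewrite integral_simple//; last by move=> i; rewrite divr_ge0// sqr_ge0.
  under eq_integral do rewrite EFinM.
  rewrite ge0_integralZl_EFin//; last 2 first.
  - by move=> x _; rewrite lee_fin sqr_ge0.
  - by apply/measurable_EFinP; exact: measurable_funX.
  rewrite leeD2l// ge0_sume_distrr; last first.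
    by move=> i _; rewrite mule_ge0 ?lee_fin ?sqr_ge0.
  by rewrite le_eqVlt; apply/orP; left; apply/eqP; apply: eq_bigr => i _;
    rewrite muleA -EFinM [(2^-1 * _)%R]mulrC.
have : 0 <= \int[nu]_x (f x ^+ 2)%:E.
  by apply: integral_ge0 => x _; rewrite lee_fin sqr_ge0.
case: (\int[nu]_x _) => [r r0|_|//].
  by move: Qfin; case: (Q) => [q _||]//; rewrite -!EFinM -EFinD !lee_fin; lra.
by move=> _; rewrite gt0_muley ?lte_fin// leey.
Qed.

(** Let P_k(x) be the sum of the b_(g i) c_i 1_(A_i)(x) over the i with
    j i = k. The left side is the integral of the sum of the v_k P_k, and
    v_k P_k <= (K v_k^2 1_(B_k) + P_k^2 / K) / 2. As j i determines g i, the
    classes of j refine those of g. The sum of the P_k^2 is therefore at most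
    the corresponding sum over the classes of g, where b is constant and can be
    taken out, and there the hypothesis on phi applies. *)
Lemma testing_bound {I J : eqType} (X : seq I) (s t : seq J) (j g : I -> J)
    (A : I -> set T) (B : J -> set T) (c : I -> R) (v b : J -> R)
    (phi : J -> T -> \bar R) (mG : J -> \bar R) (K : R) :
  (0 < K)%R -> uniq s -> uniq t ->
  {in X, forall i, j i \in s} -> {in X, forall i, g i \in t} ->
  {in X, forall i, A i `<=` B (j i)} ->
  {in X &, forall i i', j i = j i' -> g i = g i'} ->
  (forall i, measurable (A i)) -> (forall k, measurable (B k)) ->
  (forall i, 0 <= c i)%R -> (forall k, 0 <= v k)%R -> (forall k, 0 <= b k)%R ->
  (forall k, 0 <= mG k) ->
  {in t, forall k x,
    (\sum_(i <- X | g i == k) c i * \1_(A i) x)%:E <= phi k x} ->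
  {in t, forall k, \int[nu]_x (phi k x ^+ 2) <= (K ^+ 2)%:E * mG k} ->
  \sum_(i <- X) (v (j i) * b (g i) * c i)%:E * nu (A i) <=
  (K / 2)%:E * (\sum_(k <- s) (v k ^+ 2)%:E * nu (B k) +
                \sum_(k <- t) (b k ^+ 2)%:E * mG k).
Proof.
move=> K0 us ut js gt AB jg mA mB c0 v0 b0 mG0 hphi hint.
pose Phi k x := (\sum_(i <- X | g i == k) c i * \1_(A i) x)%R.
have Phi0 k x : (0 <= Phi k x)%R.
  by apply: sumr_ge0 => i _; rewrite mulr_ge0.
pose psi x i := (b (g i) * (c i * \1_(A i) x))%R.
have psi0 x i : (0 <= psi x i)%R by rewrite !mulr_ge0.
have ptw x : (\sum_(i <- X) (v (j i) * b (g i) * c i) * \1_(A i) x <=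
    \sum_(k <- s) (K / 2 * v k ^+ 2) * \1_(B k) x +
    \sum_(k <- t) (b k ^+ 2 / (2 * K)) * Phi k x ^+ 2)%R.
  pose P k := (\sum_(i <- X | j i == k) psi x i)%R.
  have P0 k : (0 <= P k)%R by exact: sumr_ge0.
  apply: (@le_trans _ _ (\sum_(k <- s) ((K / 2 * v k ^+ 2) * \1_(B k) x +
      P k ^+ 2 / (2 * K)))%R).
    rewrite (sum_fibers us js)/=; apply: ler_sum => k _.
    have -> : (\sum_(i <- X | j i == k) v (j i) * b (g i) * c i * \1_(A i) x =
        v k * P k)%R.
      by rewrite mulr_sumr; apply: eq_bigr => i /eqP <-; rewrite /psi !mulrA.
    have [xB|xB] := boolP (x \in B k).
      rewrite indicE xB mulr1 -subr_ge0.
      have -> : (K / 2 * v k ^+ 2 + P k ^+ 2 / (2 * K) - v k * P k =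
          (K * v k - P k) ^+ 2 / (2 * K))%R.
        by field; rewrite gt_eqF.
      by rewrite divr_ge0 ?sqr_ge0// mulr_ge0// ltW.
    suff -> : P k =
      0%R by rewrite expr0n/= mul0r mulr0 addr0 indicE (negbTE xB) mulr0.
    rewrite /P big_seq_cond big1// => i /andP[iX /eqP ik].
    rewrite /psi indicE memNset ?mulr0// => Ax.
    by move/negP: xB; apply; rewrite -ik; apply/mem_set/AB.
  rewrite big_split/= lerD2l -mulr_suml (sum_sqr_fibers us js).
  have -> : (\sum_(k <- t) b k ^+ 2 / (2 * K) * Phi k x ^+ 2 =
     (\sum_(k <- t) (\sum_(i <- X | g i == k) psi x i) ^+ 2) / (2 * K))%R.
    rewrite mulr_suml; apply: eq_bigr => k _.
    have -> : (\sum_(i <- X | g i == k) psi x i = b k * Phi k x)%R.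
      by rewrite mulr_sumr; apply: eq_bigr => i /eqP <-.
    by rewrite exprMn; ring.
  rewrite ler_wpM2r//; first by rewrite invr_ge0 mulr_ge0// ltW.
  rewrite (sum_sqr_fibers ut gt) big_seq [leRHS]big_seq.
  apply: ler_sum => i iX; rewrite big_mkcond [leRHS]big_mkcond/=.
  rewrite big_seq [leRHS]big_seq; apply: ler_sum => i' iX'.
  case: ifP => [/eqP /(jg _ _ iX' iX) ->|_]; first by rewrite eqxx.
  by case: ifP => // _; rewrite mulr_ge0.
have KK : ((K / 2)%:E * (\sum_(k <- t) (b k ^+ 2)%:E * mG k) =
    \sum_(k <- t) ((b k ^+ 2 / (2 * K))%:E * ((K ^+ 2)%:E * mG k))).
  rewrite ge0_sume_distrr; last by move=> k _;
    rewrite mule_ge0 ?lee_fin ?sqr_ge0.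
  apply: eq_bigr => k _; rewrite !muleA -!EFinM; congr (_%:E * _).
  by field; rewrite gt_eqF.
rewrite -integral_simple//; last by move=> i; rewrite !mulr_ge0.
apply: (le_trans (le_integral_ge0 _ _ _)).
- by move=> x; rewrite lee_fin sumr_ge0// => i _; rewrite !mulr_ge0.
- by move=> x; have := ptw x; rewrite -lee_fin; exact.
under eq_integral do rewrite EFinD.
have mPhi k : measurable_fun setT (Phi k) by exact: measurable_simple.
have m2 k : measurable_fun setT (fun x => b k ^+ 2 / (2 * K) * Phi k x ^+ 2)%R.
  by apply: measurable_funM => //; exact: measurable_funX.
have p0 k : (0 <= b k ^+ 2 / (2 * K))%R.
  by rewrite divr_ge0 ?sqr_ge0// mulr_ge0// ltW.
have v20 k : (0 <= K / 2 * v k ^+ 2)%R.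
  by rewrite mulr_ge0 ?sqr_ge0// divr_ge0// ltW.
rewrite ge0_integralD//; first last.
- by apply/measurable_EFinP; apply: measurable_sum.
- by move=> x _; rewrite lee_fin sumr_ge0// => i _; rewrite mulr_ge0// sqr_ge0.
- by apply/measurable_EFinP; apply: measurable_simple.
- by move=> x _; rewrite lee_fin sumr_ge0// => i _; rewrite mulr_ge0.
rewrite integral_simple// ge0_muleDr; last 2 first.
- by apply: sume_ge0 => k _; rewrite mule_ge0 ?lee_fin ?sqr_ge0.
- by apply: sume_ge0 => k _; rewrite mule_ge0 ?lee_fin ?sqr_ge0.
rewrite KK ge0_sume_distrr; last first.
  by move=> k _; rewrite mule_ge0 ?lee_fin ?sqr_ge0.
under [X in _ <= X + _]eq_bigr do rewrite muleA -EFinM.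
rewrite leeD2l//; under eq_integral do rewrite -sumEFin.
rewrite ge0_integral_sum//; last 2 first.
- by move=> k; apply/measurable_EFinP.
- by move=> k x _; rewrite lee_fin mulr_ge0// sqr_ge0.
rewrite big_seq [leRHS]big_seq; apply: lee_sum => k kt.
under eq_integral do rewrite EFinM.
rewrite ge0_integralZl_EFin//; last 2 first.
- by move=> x _; rewrite lee_fin sqr_ge0.
- by apply/measurable_EFinP; exact: measurable_funX.
rewrite lee_wpmul2l//; first by rewrite lee_fin.
apply: le_trans (hint k kt); apply: le_integral_ge0 => x.
  by rewrite lee_fin sqr_ge0.
rewrite EFin_expe lee_sqr//; first exact: hphi.
- by rewrite lee_fin.
- by apply: le_trans (hphi k kt x); rewrite lee_fin; exact: Phi0.
Qed.

End Embedding.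

(** * Stopping families *)

Section StoppingFamilies.
Context {R : realType}.
Implicit Types (I J K : hoi R).

Lemma exists_argmin (s : seq (hoi R)) (P : set (hoi R)) J :
  J \in s -> P J -> exists K, [/\ K \in s, P K &
    forall L, L \in s -> P L -> hlen K <= hlen L].
Proof.
elim: s J => // x s ih J;
  have [[L Ls PL] _ _|nL] := pselect (exists2 L, L \in s & P L).
  have [K [Ks PK Km]] := ih _ Ls PL.
  have [[Px xK]|nx] := pselect (P x /\ hlen x <= hlen K).
    exists x; split; rewrite ?mem_head// => L';
      rewrite inE => /orP[/eqP ->//|L's PL'].
    exact: le_trans xK (Km _ L's PL').
  exists K; split; rewrite ?inE ?Ks ?orbT// => L'.
  rewrite inE => /orP[/eqP -> Px|]; last exact: Km.
  by rewrite leNgt; apply/negP => xK; apply: nx; split => //; exact: ltW.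
rewrite inE => /orP[/eqP -> Px|Js PJ]; last by case: nL; exists J.
exists x; split; rewrite ?mem_head// => L; rewrite inE => /orP[/eqP ->//|Ls PL].
by case: nL; exists L.
Qed.

Context {c : R} (c0 : 0 < c) {E : set (hoi R)} (dE : dyadic_system c E).

(** The intervals are examined from the longest to the shortest, and one is
    selected when its value exceeds twice the value of each selected interval
    containing it. Since selected values increase as intervals shrink, the
    smallest selected interval containing I is as good for I as any other
    one. *)
Lemma stopping_family (X : seq (hoi R)) (v : hoi R -> R) :
  uniq X -> {in X, forall I, E I} -> (forall I, 0 <= v I) ->
  exists F : seq (hoi R), [/\ uniq F, {subset F <= X},
    {in F &, forall J K, J <> K -> hset K `<=` hset J -> 2 * v J <= v K} &
    {in X, forall I, exists J, [/\ J \in F, hset I `<=` hset J,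
      v I <= 2 * v J &
      forall K, K \in F -> hset I `<=` hset K -> hset J `<=` hset K]}].
Proof.
move=> uX XE v0; pose r I J := hlen I <= hlen J.
have rT : total r by move=> I J; rewrite /r le_total.
have rt : transitive r by move=> J I K; exact: le_trans.
have ss : sorted r (sort r X) := sort_sorted rT X.
have {uX} : uniq (sort r X) by rewrite sort_uniq.
have {XE} : {in sort r X, forall I, E I} by move=> I; rewrite mem_sort;
  exact: XE.
suff : sorted r (sort r X) -> {in sort r X, forall I, E I} -> uniq (sort r X) ->
    exists F : seq (hoi R), [/\ uniq F, {subset F <= sort r X},
    {in F &, forall J K, J <> K -> hset K `<=` hset J -> 2 * v J <= v K} &
    {in sort r X, forall I, exists J, [/\ J \in F, hset I `<=` hset J,
      v I <= 2 * v J &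
      forall K, K \in F -> hset I `<=` hset K -> hset J `<=` hset K]}].
  move=> h XE uX; have [F [uF FX dF sF]] := h ss XE uX.
  by exists F; split=> // [I /FX|I IX]; rewrite ?mem_sort//;
    apply: sF; rewrite mem_sort.
elim: (sort r X) => {ss X} [|x s ih]; first by exists [::].
rewrite /= path_sortedE// => /andP[/allP xs ss] XE /andP[nxs us].
have sE : {in s, forall I, E I} by move=> I Is; apply: XE; rewrite inE Is orbT.
have Ex : E x by apply: XE; rewrite mem_head.
have [F [uF Fs dF sF]] := ih ss sE us.
have nsub I : I \in s -> ~ hset I `<=` hset x.
  move=> Is Ix; have Ix' : I = x.
    by apply: hset_eq (hlen_gt0 c0 dE (sE _ Is)) Ix (xs _ Is).
  by move: nxs; rewrite -Ix' Is.
have [[J JF [xJ vJ]]|nJ] :=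
    pselect (exists2 J, J \in F & hset x `<=` hset J /\ v x <= 2 * v J).
  exists F; split => // [I /Fs|I]; first by rewrite inE => ->; rewrite orbT.
  rewrite inE => /orP[/eqP ->|/sF//].
  have [K [KF xK Km]] := exists_argmin (P := [set K | hset x `<=` hset K]) JF
    xJ.
  have xl := hset_left (hlen_gt0 c0 dE Ex).
  have KJ L : L \in F -> hset x `<=` hset L -> hset K `<=` hset L.
    move=> LF xL; apply: (nested c0 dE (sE _ (Fs _ KF)) (sE _ (Fs _ LF)))
      (xK _ xl) (xL _ xl) (Km _ LF xL).
  exists K; split => //; have [<-//|JK] := pselect (J = K).
  have := dF J K JF KF JK (KJ J JF xJ); have := v0 K; lra.
(* No selected interval controls x, so x is selected. Being the shortest, it
   contains no other interval, and the choices for the other ones stand. *)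
exists (x :: F); split.
- by rewrite /= uF andbT; apply/negP => /Fs; exact/negP.
- by move=> I; rewrite !inE => /orP[->//|/Fs ->]; rewrite orbT.
- move=> J K; rewrite !inE => /orP[/eqP ->|JF] /orP[/eqP ->|KF] //.
  + by move=> _ /nsub; case; exact: Fs.
  + move=> _ xJ; rewrite leNgt; apply/negP => vx; apply: nJ; exists J => //.
    by split => //; exact: ltW.
  + exact: dF.
- move=> I; rewrite inE => /orP[/eqP ->|Is].
    exists x; rewrite mem_head; split => //; have := v0 x; lra.
  have [J [JF IJ vI JK]] := sF I Is; exists J; split => //.
    by rewrite inE JF orbT.
  by move=> K; rewrite inE => /orP[/eqP -> /(nsub _ Is)//|]; exact: JK.
Qed.

End StoppingFamilies.

(** * The bilinear form *)

Section Bilinear.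
Context {R : realType}.
Local Open Scope ereal_scope.

Context {c : R} (c0 : (0 < c)%R) {E : set (hoi R)} (dE : dyadic_system c E).
Variables (w : {measure set (measurableTypeR R) -> \bar R}).
Variables (mu :
  {measure set (measurableTypeR R * measurableTypeR R) -> \bar R}).
Variables (K : R) (K0 : (0 < K)%R).
Hypothesis hU : forall J, E J ->
  ((hlen J ^- 2) ^+ 2)%:E * w (sib E J) * mu (box J) <= (K ^+ 2)%:E.
Hypothesis hT : forall J, E J -> 0 < w (hset J) < +oo ->
  \int[mu]_z (testT E w J z ^+ 2) <= (K ^+ 2)%:E * w (hset J).
Hypothesis hTstar : forall J, E J -> 0 < mu (box J) < +oo ->
  \int[w]_x (testTstar E mu J x ^+ 2) <= (K ^+ 2)%:E * mu (box J).

Variable X : seq (hoi R).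
Hypotheses (uX : uniq X) (XE : {in X, forall I, E I}).
Hypothesis Xw : {in X, forall I, 0 < w (sib E I) < +oo}.
Hypothesis Xmu : {in X, forall I, 0 < mu (box I) < +oo}.

Variables (f : R -> R) (g : R * R -> R).
Hypothesis mf : measurable_fun [set: measurableTypeR R] f.
Hypothesis mg : measurable_fun [set: measurableTypeR R * measurableTypeR R] g.
Hypothesis f0 : forall x, (0 <= f x)%R.
Hypothesis g0 : forall z, (0 <= g z)%R.
Hypothesis foo : \int[w]_x (f x ^+ 2)%:E < +oo.
Hypothesis goo : \int[mu]_z (g z ^+ 2)%:E < +oo.

Let v (J : hoi R) : R := mean w f (hset J).
Let b (J : hoi R) : R := mean mu g (box J).
Let lam (I : hoi R) : R := (hlen I ^- 2)%R.
Let W I := fine (w (sib E I)).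
Let M I := fine (mu (box I)).

Let v0 J : (0 <= v J)%R. Proof. exact: mean_ge0. Qed.
Let b0 J : (0 <= b J)%R. Proof. exact: mean_ge0. Qed.
Let lam0 I : (0 <= lam I)%R. Proof. by rewrite invr_ge0 sqr_ge0. Qed.
Let W0 I : (0 <= W I)%R. Proof. exact: fine_ge0. Qed.
Let M0 I : (0 <= M I)%R. Proof. exact: fine_ge0. Qed.
Let WE : {in X, forall I, w (sib E I) = (W I)%:E}.
Proof. by move=> I /Xw/andP[_ h]; rewrite fineK// ge0_fin_numE. Qed.
Let ME : {in X, forall I, mu (box I) = (M I)%:E}.
Proof. by move=> I /Xmu/andP[_ h]; rewrite fineK// ge0_fin_numE. Qed.

Let term I : R := (lam I * (v (twin E I) * W I) * (b I * M I))%R.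

Let termE : {in X, forall I, (lam I)%:E * \int[w]_(x in sib E I) (f x)%:E *
  \int[mu]_(z in box I) (g z)%:E = (term I)%:E}.
Proof.
move=> I IX; have /andP[w0 woo] := Xw IX; have /andP[m0 moo] := Xmu IX.
rewrite (meanE (measurable_sib E I) mf f0 w0 woo foo).
rewrite (meanE (measurable_box I) mg g0 m0 moo goo).
by rewrite (WE IX) (ME IX) /term /v (hset_twin c0 dE (XE IX)) -!EFinM.
Qed.

Let vb0 I J : (0 <= v I * b J)%R. Proof. exact: mulr_ge0. Qed.
Let lM0 I : (0 <= lam I * M I)%R. Proof. exact: mulr_ge0. Qed.
Let lW0 I : (0 <= lam I * W I)%R. Proof. exact: mulr_ge0. Qed.
Let lWM0 I : (0 <= lam I * W I * M I)%R. Proof. exact: mulr_ge0. Qed.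

Let N := \int[w]_x (f x ^+ 2)%:E + \int[mu]_z (g z ^+ 2)%:E.

Section Stopping.
Variables (F G : seq (hoi R)) (j k : hoi R -> hoi R).
Hypotheses (uF : uniq F) (uG : uniq G).
Hypothesis FX : {subset F <= map (twin E) X}.
Hypothesis GX : {subset G <= X}.
Hypothesis dF :
  {in F &, forall J L, J <> L -> hset L `<=` hset J -> 2 * v J <= v L}%R.
Hypothesis dG :
  {in G &, forall J L, J <> L -> hset L `<=` hset J -> 2 * b J <= b L}%R.
Hypothesis jF : {in X, forall I, j I \in F}.
Hypothesis kG : {in X, forall I, k I \in G}.
Hypothesis sub_j : {in X, forall I, hset (twin E I) `<=` hset (j I)}.
Hypothesis sub_k : {in X, forall I, hset I `<=` hset (k I)}.
Hypothesis vj : {in X, forall I, v (twin E I) <= 2 * v (j I)}%R.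
Hypothesis bk : {in X, forall I, b I <= 2 * b (k I)}%R.
Hypothesis min_j : {in X, forall I L, L \in F ->
  hset (twin E I) `<=` hset L -> hset (j I) `<=` hset L}.
Hypothesis min_k : {in X, forall I L, L \in G ->
  hset I `<=` hset L -> hset (k I) `<=` hset L}.

Let FE J : J \in F -> E J.
Proof. by move/FX/mapP => [I IX ->]; apply: (twin_in c0 dE); exact: XE. Qed.
Let GE J : J \in G -> E J.
Proof. by move/GX; exact: XE. Qed.
Let Fw J : J \in F -> 0 < w (hset J) < +oo.
Proof. by move/FX/mapP => [I IX ->]; rewrite (hset_twin c0 dE (XE IX)) Xw. Qed.

Let carl_f : \sum_(J <- F) (v J ^+ 2)%:E * w (hset J) <=
  3%:E * \int[w]_x (f x ^+ 2)%:E.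
Proof.
apply: carleson_embedding => //.
- exact: measurable_hset.
- by move=> J /Fw/andP[].
- move=> J /Fw/andP[? ?]; apply: meanE => //; exact: measurable_hset.
- move=> I J IF JF /eqP IJ x Ix Jx; have [h|h] := leP (hlen I) (hlen J).
    by right; apply: dF => //;
      [exact/nesym|exact: (nested c0 dE (FE IF) (FE JF) Ix Jx)].
  by left; apply: dF => //; exact: (nested c0 dE (FE JF) (FE IF) Jx Ix (ltW h)).
Qed.

Let carl_g : \sum_(J <- G) (b J ^+ 2)%:E * mu (box J) <=
  3%:E * \int[mu]_x (g x ^+ 2)%:E.
Proof.
apply: carleson_embedding => //.
- exact: measurable_box.
- by move=> J /GX/Xmu/andP[].
- move=> J /GX/Xmu/andP[? ?]; apply: meanE => //; exact: measurable_box.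
- move=> I J IF JF /eqP IJ x Ix Jx; have [h|h] := leP (hlen I) (hlen J).
    by right; apply: dG => //;
      [exact/nesym|exact: (box_nested c0 dE (GE IF) (GE JF) Ix Jx)].
  by left; apply: dG => //;
    exact: (box_nested c0 dE (GE JF) (GE IF) Jx Ix (ltW h)).
Qed.

Let carl : \sum_(J <- F) (v J ^+ 2)%:E * w (hset J) +
  \sum_(J <- G) (b J ^+ 2)%:E * mu (box J) <= 3%:E * N.
Proof.
rewrite ge0_muleDr ?leeD//;
  by apply: integral_ge0 => x _; rewrite lee_fin sqr_ge0.
Qed.

Let Kcarl (C : R) :
  (0 <= C)%R -> (C * (K / 2))%:E * (\sum_(J <- F) (v J ^+ 2)%:E * w (hset J) +
  \sum_(J <- G) (b J ^+ 2)%:E * mu (box J)) <= (C * (3 / 2) * K)%:E * N.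
Proof.
move=> C0; apply: le_trans (lee_wpmul2l _ carl) _.
  by rewrite lee_fin mulr_ge0// divr_ge0// ltW.
by rewrite muleA -EFinM (_ : C * (K / 2) * 3 = C * (3 / 2) * K)%R//; field.
Qed.

(** The terms attached to one stopping interval k are summed by the testing
    condition on k. *)
Lemma sum_Tstar (P : pred (hoi R)) :
  {in X, forall I, P I -> hset I `<` hset (k I)} ->
  {in X &, forall I I', P I -> P I' -> j I = j I' -> k I = k I'} ->
  (\sum_(I <- X | P I) term I)%:E <= (6 * K)%:E * N.
Proof.
move=> PT PU; apply: (@le_trans _ _ (4%:E *
   \sum_(I <- [seq I <- X | P I]) (v (j I) * b (k I) * (lam I * M I))%:E *
     w (sib E I))).
  rewrite -sumEFin big_filter ge0_sume_distrr; last first.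
    by move=> I _; rewrite mule_ge0// lee_fin; exact: mulr_ge0.
  rewrite big_seq_cond [leRHS]big_seq_cond; apply: lee_sum => I /andP[IX PI].
  rewrite (WE IX) -!EFinM lee_fin /term.
  have h : (v (twin E I) * b I <= 4 * (v (j I) * b (k I)))%R.
    rewrite (_ : 4 * _ = 2 * v (j I) * (2 * b (k I)))%R; last by ring.
    by rewrite ler_pM// ?vj ?bk.
  rewrite (_ : (lam I * _ * _ = (v (twin E I) * b I) * (lam I * W I * M I)))%R;
    last by ring.
  rewrite (_ : (4 * _ = (4 * (v (j I) * b (k I))) * (lam I * W I * M I)))%R;
    last by ring.
  by rewrite ler_wpM2r.
apply: le_trans (_ : _ <=
  (4 * (K / 2))%:E * (\sum_(J <- F) (v J ^+ 2)%:E * w (hset J) +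
  \sum_(J <- G) (b J ^+ 2)%:E * mu (box J))) _; last first.
  by apply: le_trans (Kcarl _) _ => //; rewrite (_ : 4 * (3 / 2) = 6 :> R)%R//;
    field.
rewrite EFinM -muleA lee_pmul2l//.
apply: (@testing_bound _ _ (measurableTypeR R) w _ _ [seq I <- X | P I] F G j k
  (sib E) (@hset R) (fun I => lam I * M I)%R v b (testTstar E mu)
  (fun J => mu (box J)) K K0 uF uG) => //.
- by move=> I; rewrite mem_filter => /andP[_]; exact: jF.
- by move=> I; rewrite mem_filter => /andP[_]; exact: kG.
- move=> I; rewrite mem_filter => /andP[_ IX].
  by rewrite -(hset_twin c0 dE (XE IX)); exact: sub_j.
- move=> I I'; rewrite !mem_filter => /andP[PI IX] /andP[PI' IX']; exact: PU.
- exact: measurable_sib.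
- exact: measurable_hset.
- move=> J JG x; rewrite big_filter_cond -sumEFin big_seq_cond.
  rewrite (eq_bigr (fun I => (\1_(sib E I) x)%:E *
      (mu (box I) * (hlen I ^- 2)%:E))); last first.
    move=> I /andP[IX _]; rewrite (ME IX) -!EFinM; congr EFin.
    by rewrite /lam; ring.
  rewrite -big_seq_cond; apply: sum_le_esum => //.
    by move=> I; rewrite !mule_ge0// lee_fin// invr_ge0 sqr_ge0.
  by move=> I IX /andP[PI /eqP <-]; split; [exact: XE|exact: PT I IX PI].
- by move=> J /[dup] /GE EJ /GX/Xmu; exact: hTstar.
Qed.

(** The mirror image of [sum_Tstar]. *)
Lemma sum_T (P : pred (hoi R)) :
  {in X, forall I, P I -> hset I `<` hset (j I)} ->
  {in X &, forall I I', P I -> P I' -> k I = k I' -> j I = j I'} ->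
  (\sum_(I <- X | P I) term I)%:E <= (6 * K)%:E * N.
Proof.
move=> PT PU; apply: (@le_trans _ _ (4%:E *
   \sum_(I <- [seq I <- X | P I]) (b (k I) * v (j I) * (lam I * W I))%:E *
     mu (box I))).
  rewrite -sumEFin big_filter ge0_sume_distrr; last first.
    by move=> I _; rewrite mule_ge0// lee_fin; apply: mulr_ge0 => //;
      exact: mulr_ge0.
  rewrite big_seq_cond [leRHS]big_seq_cond; apply: lee_sum => I /andP[IX PI].
  rewrite (ME IX) -!EFinM lee_fin /term.
  have h : (v (twin E I) * b I <= 4 * (v (j I) * b (k I)))%R.
    rewrite (_ : 4 * _ = 2 * v (j I) * (2 * b (k I)))%R; last by ring.
    by rewrite ler_pM// ?vj ?bk.
  rewrite (_ : (lam I * _ * _ = (v (twin E I) * b I) * (lam I * W I * M I)))%R;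
    last by ring.
  rewrite (_ : (4 * _ = (4 * (v (j I) * b (k I))) * (lam I * W I * M I)))%R;
    last by ring.
  by rewrite ler_wpM2r.
apply: le_trans (_ : _ <=
  (4 * (K / 2))%:E * (\sum_(J <- G) (b J ^+ 2)%:E * mu (box J) +
  \sum_(J <- F) (v J ^+ 2)%:E * w (hset J))) _; last first.
  rewrite addeC.
  by apply: le_trans (Kcarl _) _ => //; rewrite (_ : 4 * (3 / 2) = 6 :> R)%R//;
    field.
rewrite EFinM -muleA lee_pmul2l//.
apply: (@testing_bound _ _ (measurableTypeR R * measurableTypeR R)%type mu _ _
  [seq I <- X | P I] G F k j
  (@box R) (@box R) (fun I => lam I * W I)%R b v (testT E w)
  (fun J => w (hset J)) K K0 uG uF) => //.
- by move=> I; rewrite mem_filter => /andP[_]; exact: kG.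
- by move=> I; rewrite mem_filter => /andP[_]; exact: jF.
- move=> I; rewrite mem_filter => /andP[_ IX].
  by apply: box_sub; [exact: (hlen_gt0 c0 dE (XE IX))|exact: sub_k].
- move=> I I'; rewrite !mem_filter => /andP[PI IX] /andP[PI' IX']; exact: PU.
- exact: measurable_box.
- exact: measurable_box.
- move=> J JF x; rewrite big_filter_cond -sumEFin big_seq_cond.
  rewrite (eq_bigr (fun I => (\1_(box I) x * hlen I ^- 2)%:E * w (sib E I)));
    last first.
    move=> I /andP[IX _]; rewrite (WE IX) -!EFinM; congr EFin.
    by rewrite /lam; ring.
  rewrite -big_seq_cond; apply: sum_le_esum => //.
    by move=> I; rewrite !mule_ge0// lee_fin mulr_ge0// invr_ge0 sqr_ge0.
  by move=> I IX /andP[PI /eqP <-]; split; [exact: XE|exact: PT I IX PI].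
- by move=> J /[dup] /FE EJ /Fw; exact: hT.
Qed.

(** The averages of f over twin I and of g over box I are now stopping values,
    so the terms may be estimated one at a time. *)
Lemma sum_U (P : pred (hoi R)) :
  {in X, forall I, P I -> twin E I \in F /\ I \in G} ->
  (\sum_(I <- X | P I) term I)%:E <= (2 * K)%:E * N.
Proof.
move=> PU; pose XP := [seq I <- X | P I].
have uXP : uniq XP by exact: filter_uniq.
have XPX I : I \in XP -> I \in X /\ P I by rewrite mem_filter => /andP[].
apply: (@le_trans _ _ (\sum_(I <- XP) (K / 2)%:E *
    ((v (twin E I) ^+ 2)%:E * w (hset (twin E I)) + (b I ^+ 2)%:E *
      mu (box I)))).
  rewrite -sumEFin -big_filter big_seq [leRHS]big_seq; apply: lee_sum => I.
  move=> /XPX[IX PI]; rewrite (hset_twin c0 dE (XE IX)) (WE IX) (ME IX).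
  rewrite -[X in _ * (X + _)]EFinM -[X in _ * (_ + X)]EFinM -EFinD -EFinM
    lee_fin /term.
  have := hU (XE IX); rewrite (WE IX) (ME IX) -!EFinM lee_fin -/(lam I).
  move: (v _) (b I) (lam I) (W I) (M I) (W0 I) (M0 I) => x y l W' M' W'0 M'0 h.
  (* The first square is the discrepancy between the two factors; the second
     summand is nonnegative by the single-term condition. *)
  rewrite -subr_ge0 -(pmulr_rge0 _ K0).
  rewrite [X in (_ <= X)%R](_ : (_ = (W' * (K * x - l * y * M') ^+ 2 +
     y ^+ 2 * M' * (K ^+ 2 - l ^+ 2 * W' * M')) / 2))%R; last by field.
  rewrite divr_ge0// addr_ge0//; first by rewrite mulr_ge0 ?sqr_ge0.
  by apply: mulr_ge0; [apply: mulr_ge0 => //; exact: sqr_ge0|rewrite subr_ge0].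
rewrite -ge0_sume_distrr; last first.
  by move=> I _; rewrite adde_ge0// mule_ge0// lee_fin sqr_ge0.
apply: (@le_trans _ _ ((1 * (3 / 2) * K)%:E * N)); last first.
  rewrite lee_wpmul2r// ?lee_fin; first by rewrite adde_ge0//;
    apply: integral_ge0 => x _; rewrite lee_fin sqr_ge0.
  by have := K0; lra.
apply: le_trans (Kcarl _) => //; rewrite mul1r lee_wpmul2l//.
  by rewrite lee_fin divr_ge0// ltW.
have p0 (r : R) (y : \bar R) : 0 <= y -> 0 <= (r ^+ 2)%:E * y.
  by move=> y0; rewrite mule_ge0// lee_fin sqr_ge0.
rewrite big_split/= leeD//; last first.
  by apply: sum_le_subset => // [I /XPX[IX PI]|I];
    [exact: (PU I IX PI).2|exact: p0].
rewrite -(big_map (twin E) xpredT (fun J => (v J ^+ 2)%:E * w (hset J))).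
apply: sum_le_subset => // [|J|J]; last exact: p0.
  rewrite map_inj_in_uniq// => I J /XPX[IX _] /XPX[JX _].
  by move/(congr1 (twin E)); rewrite !(twinK c0 dE)//; exact: XE.
by move=> /mapP[I /XPX[IX PI] ->]; exact: (PU I IX PI).1.
Qed.

(** The parent of I lies in every interval of E strictly larger than twin I and
    in every one strictly larger than I. Hence, unless j I = twin I and
    k I = I, the intervals j I and k I meet and are nested. If j I is strictly
    inside k I, then k I is the smallest stopping interval for g that contains
    the parent of j I: it is determined by j I. *)
Lemma sum_terms_le : (\sum_(I <- X) term I)%:E <= (20 * K)%:E * N.
Proof.
have N0 : 0 <= N.
  by rewrite adde_ge0//; apply: integral_ge0 => x _; rewrite lee_fin sqr_ge0.
have jE I : I \in X -> E (j I) by move=> IX; apply/FE/jF.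
have kE I : I \in X -> E (k I) by move=> IX; apply/GE/kG.
have tE I : I \in X -> E (twin E I) by move=> IX; apply: (twin_in c0 dE);
  exact: XE.
have twin_anc I J : I \in X -> E J -> hset (twin E I) `<` hset J ->
  hset I `<=` hset J.
  move=> IX EJ tJ; apply: subset_trans (proper_anc c0 dE (tE _ IX) EJ tJ).
  have [_ _ _ -> _] := twinP c0 dE (XE IX); exact: (anc_sub c0 dE 1 (XE IX)).
have I_anc I J : I \in X -> E J -> hset I `<` hset J ->
  hset (twin E I) `<=` hset J.
  move=> IX EJ tJ; rewrite (hset_twin c0 dE (XE IX)).
  exact: (sib_sub c0 dE (XE IX)).
have kt I : I \in X -> k I <> twin E I.
  move=> IX kI; have := sub_k IX; rewrite kI (hset_twin c0 dE (XE IX)).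
  by move=> /(_ _ (hset_left (hlen_gt0 c0 dE (XE IX))))[_]; apply;
    exact/hset_left/(hlen_gt0 c0 dE (XE IX)).
pose PA I : bool := `[< hset (j I) `<` hset (k I) >].
pose PB I : bool := `[< hset (k I) `<` hset (j I) >].
pose PC I : bool := j I == k I.
rewrite (bigID PA)/= [X in (_ + X)%R](bigID PB)/=
  [X in (_ + (_ + X))%R](bigID PC)/=.
rewrite !EFinD (_ : (20 * K = 6 * K + (6 * K + (6 * K + 2 * K)))%R);
  last by ring.
have K6 : (0 <= 6 * K)%R by rewrite mulr_ge0// ltW.
have K2 : (0 <= 2 * K)%R by rewrite mulr_ge0// ltW.
rewrite EFinD ge0_muleDl ?lee_fin ?addr_ge0// leeD//.
  apply: sum_Tstar =>
    [I IX /asboolP jk|I I' IX IX' /asboolP jk /asboolP jk' jj].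
    apply: (proper_twin c0 dE) (kt _ IX); [exact: XE|exact: kE|].
    by apply: subset_trans (properW jk); exact: sub_j.
  have sub I1 I2 : I1 \in X -> I2 \in X -> hset (j I1) `<` hset (k I1) ->
      j I1 = j I2 -> hset (k I2) `<=` hset (k I1).
    move=> IX1 IX2 h12 j12; apply: min_k => //; first exact: kG.
    apply: twin_anc (kE _ IX1) _ => //; apply: subset_proper _ h12.
    by rewrite j12; exact: sub_j.
  by apply: (hset_inj c0 dE) (kE _ IX) (kE _ IX') _; apply/seteqP; split;
    apply: sub => //.
rewrite EFinD ge0_muleDl ?lee_fin ?addr_ge0// leeD//.
  apply: sum_T => [I IX /andP[_ /asboolP jk]|].
    by apply: subset_proper _ jk; exact: sub_k.
  move=> I I' IX IX' /andP[_ /asboolP jk] /andP[_ /asboolP jk'] jj.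
  have sub I1 I2 : I1 \in X -> I2 \in X -> hset (k I1) `<` hset (j I1) ->
      k I1 = k I2 -> hset (j I2) `<=` hset (j I1).
    move=> IX1 IX2 h12 j12; apply: min_j => //; first exact: jF.
    apply: I_anc (jE _ IX1) _ => //; apply: subset_proper _ h12.
    by rewrite j12; exact: sub_k.
  by apply: (hset_inj c0 dE) (jE _ IX) (jE _ IX') _; apply/seteqP; split;
    apply: sub => //.
rewrite EFinD ge0_muleDl ?lee_fin ?addr_ge0// leeD//.
  apply: sum_Tstar => [I IX /andP[_ /eqP jk]|].
    apply: (proper_twin c0 dE) (kt _ IX); [exact: XE|exact: kE|].
    by rewrite -jk; exact: sub_j.
  by move=> I I' IX IX' /andP[_ /eqP <-] /andP[_ /eqP <-].
apply: sum_U => I IX /andP[/andP[/asboolP nA /asboolP nB] /eqP nC].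
have nn x : hset (j I) x -> hset (k I) x -> False.
  move=> jx kx; have [jk|kj] := leP (hlen (j I)) (hlen (k I)).
    apply: nA; rewrite properEneq; split.
      by apply/eqP => /(hset_inj c0 dE (jE _ IX) (kE _ IX)).
    exact: (nested c0 dE (jE _ IX) (kE _ IX) jx kx).
  apply: nB; rewrite properEneq; split.
    by apply/eqP => /(hset_inj c0 dE (kE _ IX) (jE _ IX))/esym.
  exact: (nested c0 dE (kE _ IX) (jE _ IX) kx jx (ltW kj)).
have Il := hset_left (hlen_gt0 c0 dE (XE IX)).
have tl := hset_left (hlen_gt0 c0 dE (tE _ IX)).
split.
  suff -> : twin E I = j I by exact: jF.
  apply: contrapT => tj; apply: (nn I.1); last exact: sub_k Il.
  apply: (twin_anc _ _ IX (jE _ IX)) Il; rewrite properEneq; split;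
    last exact: sub_j.
  by apply/eqP => /(hset_inj c0 dE (tE _ IX) (jE _ IX)).
suff Ik : I = k I by rewrite {1}Ik; exact: kG.
apply: contrapT => tj; apply: (nn (twin E I).1); first exact: sub_j tl.
apply: (I_anc _ _ IX (kE _ IX)) tl; rewrite properEneq; split;
  last exact: sub_k.
by apply/eqP => /(hset_inj c0 dE (XE IX) (kE _ IX)).
Qed.

End Stopping.

Theorem bilinear_bound :
  \sum_(I <- X) (hlen I ^- 2)%:E * \int[w]_(x in sib E I) (f x)%:E *
    \int[mu]_(z in box I) (g z)%:E <=
  (20 * K)%:E * (\int[w]_x (f x ^+ 2)%:E + \int[mu]_z (g z ^+ 2)%:E).
Proof.
rewrite (eq_big_seq (fun I => (term I)%:E)); last by move=> I IX; exact: termE.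
have utX : uniq (map (twin E) X).
  rewrite map_inj_in_uniq// => I J IX JX.
  by move/(congr1 (twin E)); rewrite !(twinK c0 dE)//; exact: XE.
have tXE : {in map (twin E) X, forall I, E I}.
  by move=> _ /mapP[I IX ->]; apply: (twin_in c0 dE); exact: XE.
have [F [uF FX dF sF]] := stopping_family c0 dE utX tXE v0.
have [G [uG GX dG sG]] := stopping_family c0 dE uX XE b0.
have [j jP] : {j : hoi R -> hoi R & forall I, I \in X -> [/\ j I \in F,
    hset (twin E I) `<=` hset (j I), (v (twin E I) <= 2 * v (j I))%R &
    forall L, L \in F -> hset (twin E I) `<=` hset L ->
      hset (j I) `<=` hset L]}.
  apply: (@choice _ _ (fun I J => I \in X -> [/\ J \in F,
    hset (twin E I) `<=` hset J, (v (twin E I) <= 2 * v J)%R &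
    forall L, L \in F -> hset (twin E I) `<=` hset L -> hset J `<=` hset L])) =>
      I.
  have [IX|nIX] := boolP (I \in X); last by exists I.
  by have [J hJ] := sF _ (map_f (twin E) IX); exists J.
have [k kP] : {k : hoi R -> hoi R & forall I, I \in X -> [/\ k I \in G,
    hset I `<=` hset (k I), (b I <= 2 * b (k I))%R &
    forall L, L \in G -> hset I `<=` hset L -> hset (k I) `<=` hset L]}.
  apply: (@choice _ _ (fun I J => I \in X -> [/\ J \in G,
    hset I `<=` hset J, (b I <= 2 * b J)%R &
    forall L, L \in G -> hset I `<=` hset L -> hset J `<=` hset L])) => I.
  have [IX|nIX] := boolP (I \in X); last by exists I.
  by have [J hJ] := sG _ IX; exists J.
rewrite sumEFin; apply: (@sum_terms_le F G j k) => //.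
- by move=> I /jP[].
- by move=> I /kP[].
- by move=> I /jP[].
- by move=> I /kP[].
- by move=> I /jP[].
- by move=> I /kP[].
- by move=> I IX L; have [_ _ _] := jP I IX; exact.
- by move=> I IX L; have [_ _ _] := kP I IX; exact.
Qed.

End Bilinear.

(** * The dyadic Poisson integral as a sum over siblings *)

Section Poisson.
Context {R : realType}.
Local Open Scope ereal_scope.

Definition sib_term (E : set (hoi R)) (w :
  {measure set (measurableTypeR R) -> \bar R})
    (f : R -> R) (J : hoi R) : \bar R :=
  (hlen J ^- 2)%:E * \int[w]_(x in sib E J) (f x)%:E.

Context {c : R} (c0 : (0 < c)%R) {E : set (hoi R)} (dE : dyadic_system c E).
Variables (w : {measure set (measurableTypeR R) -> \bar R}).

Lemma sib_term_ge0 f J : (forall x, 0 <= f x)%R -> 0 <= sib_term E w f J.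
Proof.
move=> f0; rewrite mule_ge0//; first by rewrite lee_fin invr_ge0 sqr_ge0.
by apply: integral_ge0 => x _; rewrite lee_fin.
Qed.

Section Nonneg.
Variable f : R -> R.
Hypothesis mf : measurable_fun [set: measurableTypeR R] f.
Hypothesis f0 : forall x, (0 <= f x)%R.

Let off (I : hoi R) (x : R) : R := (\1_(~` hset I) x * f x)%R.
Let off0 I x : (0 <= off I x)%R. Proof. by rewrite mulr_ge0. Qed.
Let moff I : measurable_fun [set: measurableTypeR R] (off I).
Proof.
apply: measurable_funM => //; apply: measurable_indic; apply: measurableC.
exact: measurable_hset.
Qed.
Let S I j := \int[w]_(x in hset (anc E I j)) (off I x)%:E.
Let S_ge0 I j : 0 <= S I j.
Proof. by apply: integral_ge0 => x _; rewrite lee_fin. Qed.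

Let S0 I : E I -> S I 0 = 0.
Proof.
move=> EI; rewrite /S (anc0 c0 dE EI); apply: integral0_eq => x Ix.
by rewrite /off indicE memNset ?mul0r//= => /(_ Ix).
Qed.

Let SS I j : E I -> S I j.+1 =
  S I j + \int[w]_(x in sib E (anc E I j)) (f x)%:E.
Proof.
move=> EI; have EA := anc_in c0 dE j EI.
have -> : S I j.+1 =
  \int[w]_(x in hset (anc E I j) `|` sib E (anc E I j)) (off I x)%:E.
  rewrite /S /sib -(ancS c0 dE j EI).
  congr (\int[w]_(x in _) _); rewrite setDUK//.
  exact: (anc_le c0 dE EI (leqnSn j)).
rewrite ge0_integral_setU//; first last.
- by apply/disj_setPS => x [Ax [_]].
- by move=> x _; rewrite lee_fin.
- by apply/measurable_EFinP; exact: measurable_funTS.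
- exact: measurable_sib.
- exact: measurable_hset.
congr (_ + _); apply: eq_integral => x /set_mem[_ nx].
rewrite /off indicE mem_set ?mul1r//= => Ix; apply: nx.
exact: (anc_sub c0 dE j EI).
Qed.

Let lam (I : hoi R) j : R := (hlen (anc E I j) ^- 2)%R.
Let lam0 I j : (0 <= lam I j)%R. Proof. by rewrite invr_ge0 sqr_ge0. Qed.
Let lamS I j : E I -> lam I j = (4 * lam I j.+1)%R.
Proof.
move=> EI; rewrite /lam !(hlen_anc c0 dE)// [(2 ^+ j.+1)%R]exprS.
have l0 := hlen_gt0 c0 dE EI.
by field; rewrite lt0r_neq0//= expf_neq0.
Qed.

(** The mass of each sibling enters all later terms of the series, whose weights
    form a geometric progression. *)
Lemma poisson_le I : E I ->
  dyadic_poisson E w (fun x => \1_(~` hset I) x * f x)%R I <=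
  \sum_(0 <= k <oo) sib_term E w f (anc E I k).
Proof.
move=> EI; rewrite /dyadic_poisson.
have pos j : 0 <= (lam I j)%:E * S I j by rewrite mule_ge0 ?lee_fin.
apply: lee_lim.
- by apply: is_cvg_nneseries => j _ _; exact: pos.
- by apply: is_cvg_nneseries => j _ _; exact: sib_term_ge0.
- apply: nearW => n.
(* The additional term is the total contribution of S_n to the terms of index
   at least n, as the weights decrease by factors of 4. *)
suff : \sum_(0 <= j < n) (lam I j)%:E * S I j + (4 / 3 * lam I n)%:E * S I n <=
    \sum_(0 <= k < n) sib_term E w f (anc E I k).
  by apply: le_trans; rewrite leeDl// mule_ge0// lee_fin mulr_ge0.
elim: n => [|n ih]; first by rewrite !big_nil add0e S0// mule0.
rewrite !big_nat_recr//=; apply: le_trans (leeD2r _ ih).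
rewrite SS// /sib_term -/(lam I n) (lamS n EI).
have : 0 <= \int[w]_(x in sib E (anc E I n)) (f x)%:E.
  by apply: integral_ge0 => x _; rewrite lee_fin.
move: (integral _ _ _) (S I n) (S_ge0 I n) (lam I n.+1) (lam0 I n.+1).
move=> q s s0 l l0 q0.
rewrite -!addeA leeD2l// ge0_muleDr// addeA -ge0_muleDl ?lee_fin ?mulr_ge0//.
rewrite -EFinD (_ : 4 * l + _ = 4 / 3 * (4 * l))%R; last by field.
by rewrite leeD2l// lee_wpmul2r// lee_fin; lra.
Qed.

(** In the term of index j + 1 keep only the sibling that was added last; its
    weight is a quarter of lam_(I^(j)). *)
Lemma poisson_ge I : E I ->
  \esum_(J in E `&` [set J | hset I `<=` hset J]) sib_term E w f J <=
  4%:E * dyadic_poisson E w (fun x => \1_(~` hset I) x * f x)%R I.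
Proof.
move=> EI; have pos j : 0 <= (lam I j)%:E * S I j by rewrite mule_ge0 ?lee_fin.
rewrite (reindex_esum [set: nat] _ (anc E I)); last first.
  split.
  - move=> k _; split; [exact: (anc_in c0 dE)|exact: (anc_sub c0 dE)].
  - by move=> i j _ _; exact: (anc_inj c0 dE).
  - by move=> J [EJ IJ]; have [k ->] := sub_anc c0 dE EI EJ IJ; exists k.
rewrite -nneseries_esumT; last by move=> k; exact: sib_term_ge0.
rewrite /dyadic_poisson -nneseriesZl; last by move=> j _; exact: pos.
have p4 j : 0 <= 4%:E * ((lam I j)%:E * S I j) by rewrite mule_ge0.
rewrite [leRHS](nneseries_recl (fun k _ => p4 k))//.
rewrite (S0 EI) !mule0 add0e -(nneseries_addn 1); last first.
  by move=> j; exact: p4.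
apply: lee_nneseries => [j _ _|j _]; first exact: sib_term_ge0.
rewrite addn1.
change (sib_term E w f (anc E I j) <= 4%:E * ((lam I j.+1)%:E * S I j.+1)).
rewrite muleA -EFinM -(lamS j EI) SS// lee_wpmul2l ?lee_fin//;
  first exact: lam0.
by rewrite leeDr//; exact: S_ge0.
Qed.

End Nonneg.

(** Where the series of |h| converges, that of h converges absolutely. *)
Lemma poisson_abs (h : R -> R) I :
  measurable_fun [set: measurableTypeR R] h -> E I ->
  let Q f := dyadic_poisson E w (fun x => \1_(~` hset I) x * f x)%R I in
  Q (fun x => `|h x|)%R < +oo -> Q h ^+ 2 <= Q (fun x => `|h x|)%R ^+ 2.
Proof.
move=> mh EI Q Qoo.
pose a (f : R -> R) j := (hlen (anc E I j) ^- 2)%:E *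
  \int[w]_(x in hset (anc E I j)) (\1_(~` hset I) x * f x)%:E.
have ah j : `|a h j| <= a (fun x => `|h x|)%R j.
  have mA := measurable_hset (anc E I j).
  have mhI : measurable_fun (hset (anc E I j))
    (fun x => \1_(~` hset I) x * h x)%R.
    apply: measurable_funM; last exact: measurable_funTS.
    by apply: measurable_indic; apply: measurableC; exact: measurable_hset.
  rewrite /a abseM gee0_abs ?lee_fin ?invr_ge0 ?sqr_ge0// lee_wpmul2l
    ?lee_fin//.
    by rewrite invr_ge0 sqr_ge0.
  apply: le_trans (le_abse_integral _ mA _) _; first exact/measurable_EFinP.
  rewrite le_eqVlt; apply/orP; left; apply/eqP; apply: eq_integral => x _ /=.
  by rewrite normrM ger0_norm.
have a0 j : 0 <= a (fun x => `|h x|)%R j.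
  by apply: le_trans (ah j).
have sh : summable [set: nat] (a h).
  rewrite /summable -nneseries_esumT//; apply: le_lt_trans Qoo.
  by apply: lee_nneseries => // j _; exact: ah.
have {}sh : summable (xpredT : set nat) (a h).
  by rewrite (_ : (xpredT : set nat) = setT)//; apply/seteqP.
have : `|Q h| <= Q (fun x => `|h x|)%R.
  rewrite /Q /dyadic_poisson -/(a h).
  rewrite (_ : \sum_(0 <= j <oo) _ = \sum_(j <oo) a h j)// summable_eseries//.
  apply: (@le_trans _ _ (\sum_(0 <= j <oo) `|a h j|)); last first.
    by apply: lee_nneseries => // j _; exact: ah.
  apply: le_trans (lee_abs_sub _ _) _.
  rewrite !gee0_abs ?nneseries_ge0// -nneseriesD//.
  apply: lee_nneseries => [j _ _|j _]; first by rewrite adde_ge0.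
  by rewrite -[leLHS]/(((a h)^\+ \+ (a h)^\-) j) -fune_abse.
move=> QQ; rewrite -[X in X <= _]gee0_abs; last by rewrite sqre_ge0.
by rewrite expe2 abseM -expe2 lee_sqr// (le_trans _ QQ).
Qed.

End Poisson.

(** * The measure on the half-plane *)

Section Whitney.
Context {R : realType}.
Local Open Scope ereal_scope.

Lemma measurable_point (z : measurableTypeR R * measurableTypeR R) :
  measurable [set z].
Proof.
rewrite (_ : [set z] = [set z.1] `*` [set z.2]); last first.
  by case: z => a b; apply/seteqP; split => [_ ->//|[x y] /= [-> ->]].
by apply: measurableX; exact: measurable_set1.
Qed.

Context {c : R} (c0 : (0 < c)%R) {E : set (hoi R)} (dE : dyadic_system c E).
Context {m : hoi R -> \bar R} (m0 : forall I, 0 <= m I).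

Let mu : {measure set (measurableTypeR R * measurableTypeR R) -> \bar R} :=
  whitney_measure E m0.

Lemma whitney_box J : E J ->
  mu (box J) = \esum_(I in E `&` [set I | hset I `<=` hset J]) m I.
Proof.
move=> EJ; rewrite esum_mkcondr; apply: eq_esum => I EI; rewrite diracE.
have := box_whitney c0 dE EI EJ; case: ifPn => [/set_mem IJ bIJ|nIJ bIJ].
  by rewrite mem_set ?mule1//; exact/bIJ.
rewrite memNset ?mule0// => /bIJ IJ; move/negP: nIJ; apply; exact/mem_set.
Qed.

Lemma whitney_point I : E I -> mu [set whitney_centre I] = m I.
Proof.
move=> EI; transitivity (\esum_(J in E `&` [set I]) m J).
  rewrite esum_mkcondr; apply: eq_esum => J EJ; rewrite diracE.
  case: ifPn => [/set_mem ->|nIJ]; first by rewrite mem_set ?mule1.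
  rewrite memNset ?mule0// => /whitney_centre_inj JI; move/negP: nIJ; apply.
  exact/mem_set.
by rewrite setIidr ?esum_set1// => _ ->.
Qed.

Lemma whitney_pointI I J : E I -> E J ->
  mu ([set whitney_centre I] `&` box J) =
  if `[< hset I `<=` hset J >] then m I else 0.
Proof.
move=> EI EJ; have bIJ := box_whitney c0 dE EI EJ; case: asboolP => IJ.
  rewrite (_ : _ `&` _ = [set whitney_centre I]) ?whitney_point//.
  by apply/setIidPl => _ ->; exact/bIJ.
rewrite (_ : _ `&` _ = set0) ?measure0//.
by apply/seteqP; split => // _ [-> /bIJ].
Qed.

(** A simple function below phi is integrated by exchanging the finite sum over
    its values with the sum over the atoms. *)
Lemma integral_whitney_le (phi : R * R -> \bar R) : (forall z, 0 <= phi z) ->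
  \int[mu]_z phi z <= \esum_(I in E) m I * phi (whitney_centre I).
Proof.
move=> phi0; rewrite ge0_integralTE//; apply: ge_ereal_sup => _ [h hphi <-].
pose g : R * R -> R := h; have g0 z : (0 <= g z)%R by [].
have fg : finite_set (range g) by exact: (fimfunP h).
rewrite sintegralE fsbig_finite//=.
have t0 (x : R) I : 0 <= x%:E * (m I * \d_(whitney_centre I) (g @^-1` [set x])).
  rewrite diracE; case: (boolP (_ \in _)) => [/set_mem /= <-|_].
    by rewrite mule1 mule_ge0// lee_fin.
  by rewrite !mule0.
have : \sum_(x <- finmap.enum_fset (fset_set (range h))) x%:E *
  mu (h @^-1` [set x]) <=
    \sum_(x <- finmap.enum_fset (fset_set (range g))) \esum_(I in E)
      (x%:E * (m I * \d_(whitney_centre I) (g @^-1` [set x]))).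
  rewrite big_seq [leRHS]big_seq; apply: lee_sum => x.
  rewrite in_fset_set// inE => -[z _ gz].
  by apply: esumZl_le => [|I]; [rewrite -gz|rewrite mule_ge0].
move/le_trans; apply; rewrite -esum_sum//; apply: le_esum => I EI.
rewrite (bigD1_seq (g (whitney_centre I)))/= ?finmap.fset_uniq//; last first.
  by rewrite in_fset_set//; apply/mem_set; exists (whitney_centre I).
rewrite diracE mem_set// mule1 big1 ?adde0; last first.
  by move=> x xh; rewrite diracE memNset ?mule0//= => /esym/eqP; exact/negP.
by rewrite muleC lee_wpmul2l//; exact: hphi.
Qed.

Section Atoms.
Variables (A : seq (hoi R)) (a : hoi R -> R).
Hypotheses (uA : uniq A) (AE : {in A, forall I, E I}) (a0 :
  forall I, (0 <= a I)%R).

(** The function on the half-plane that takes the value a I at the Whitney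
    centre of I; the dual function has this form. *)
Definition atoms (z : R * R) : R :=
  (\sum_(I <- A) a I * \1_[set whitney_centre I] z)%R.

Lemma atoms_ge0 z : (0 <= atoms z)%R.
Proof. by apply: sumr_ge0 => I _; rewrite mulr_ge0. Qed.

Lemma measurable_atoms :
  measurable_fun [set: measurableTypeR R * measurableTypeR R] atoms.
Proof. by apply: measurable_simple => I; exact: measurable_point. Qed.

Lemma integral_atoms J : E J -> \int[mu]_(z in box J) (atoms z)%:E =
  \sum_(I <- A) (a I)%:E * if `[< hset I `<=` hset J >] then m I else 0.
Proof.
move=> EJ; rewrite integral_mkcond.
under eq_integral => z _.
  rewrite (_ : _ z = (\sum_(I <- A) a I *
      \1_([set whitney_centre I] `&` box J) z)%:E); last first.
    rewrite patchE; case: ifPn => zJ.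
      congr EFin; apply: eq_bigr => I _; congr (_ * _)%R.
      by rewrite !indicE in_setI zJ andbT.
    by rewrite big1// => I _; rewrite indicE in_setI (negbTE zJ) andbF mulr0.
  over.
rewrite integral_simple//; last first.
  by move=> I; apply: measurableI;
    [exact: measurable_point|exact: measurable_box].
by apply: eq_big_seq => I IA; rewrite whitney_pointI//; exact: AE.
Qed.

Lemma integral_atoms_sqr : \int[mu]_z (atoms z ^+ 2)%:E =
  \sum_(I <- A) (a I ^+ 2)%:E * m I.
Proof.
transitivity (\int[mu]_z
  (\sum_(I <- A) a I ^+ 2 * \1_[set whitney_centre I] z)%:E).
  apply: eq_integral => z _; congr EFin; rewrite /atoms.
  have [[I0 IA ->]|nz] := pselect (exists2 I, I \in A & z = whitney_centre I).
    have ind I (r : R) : (r * \1_[set whitney_centre I] (whitney_centre I0) =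
        if I0 == I then r else 0)%R.
      case: eqVneq => [->|I0I]; first by rewrite indicE mem_set ?mulr1.
      by rewrite indicE memNset ?mulr0// => /whitney_centre_inj/eqP; exact/negP.
    under eq_bigr do rewrite ind; under [RHS]eq_bigr do rewrite ind.
    by rewrite (sum_if_eq a uA IA) (sum_if_eq (fun I => a I ^+ 2)%R uA IA).
  rewrite big_seq big1 ?expr0n/=; last first.
    by move=> I IA; rewrite indicE memNset ?mulr0// => zI; apply: nz; exists I.
  rewrite big_seq big1// => I IA.
  by rewrite indicE memNset ?mulr0// => zI; apply: nz; exists I.
rewrite integral_simple//.
- by apply: eq_big_seq => I IA; rewrite whitney_point//; exact: AE.
- by move=> I; exact: sqr_ge0.
- by move=> I; exact: measurable_point.
Qed.

End Atoms.

Section Sufficiency.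
Variables (w : {measure set (measurableTypeR R) -> \bar R}).
Hypothesis hw : forall I, E I -> w (hset I) < +oo.
Variables (K : R) (K0 : (0 < K)%R).
Hypothesis hU : forall J, E J ->
  ((hlen J ^- 2) ^+ 2)%:E * w (sib E J) * mu (box J) <= (K ^+ 2)%:E.
Hypothesis hT : forall J, E J -> 0 < w (hset J) < +oo ->
  \int[mu]_z (testT E w J z ^+ 2) <= (K ^+ 2)%:E * w (hset J).
Hypothesis hTstar : forall J, E J -> 0 < mu (box J) < +oo ->
  \int[w]_x (testTstar E mu J x ^+ 2) <= (K ^+ 2)%:E * mu (box J).

Lemma sib_lty I : E I -> w (sib E I) < +oo.
Proof.
by move=> EI; rewrite -(hset_twin c0 dE EI) hw//; exact: (twin_in c0 dE).
Qed.

Variable f : R -> R.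
Hypothesis mf : measurable_fun [set: measurableTypeR R] f.
Hypothesis f0 : forall x, (0 <= f x)%R.
Hypothesis foo : \int[w]_x (f x ^+ 2)%:E < +oo.

Let sib_term_fin I : E I -> sib_term E w f I \is a fin_num.
Proof.
move=> EI; rewrite fin_numM// ge0_fin_numE; last first.
  by apply: integral_ge0 => x _; rewrite lee_fin.
apply: integral_L2_lty => //; first exact: measurable_sib.
exact: sib_lty.
Qed.

Let sib_term0 I : w (sib E I) = 0 -> sib_term E w f I = 0.
Proof.
move=> wI; rewrite /sib_term null_set_integral ?mule0//.
- exact: measurable_sib.
- by apply/measurable_EFinP; exact: measurable_funTS.
Qed.

(** Duality. Let u_I be the inner sum, S the left side, and let g take the value
    eps u_I at the centre of I. Exchanging sums, eps S is at most the bilinear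
    form of f and g, hence at most 20 K (|f|^2 + eps^2 S), and for
    eps = 1 / (40 K) the last term is absorbed. Only intervals J with
    w (sib J) > 0 enter the form; for those U makes mu (box J) finite. *)
Lemma finite_sum_bound (A : seq (hoi R)) n : uniq A ->
  {in A, forall I, E I} -> {in A, forall I, 0 < m I < +oo} ->
  \sum_(I <- A) m I * (\sum_(0 <= k < n) sib_term E w f (anc E I k)) ^+ 2 <=
  ((40 * K) ^+ 2)%:E * \int[w]_x (f x ^+ 2)%:E.
Proof.
move=> uA AE Am.
pose u I := \sum_(0 <= k < n) sib_term E w f (anc E I k).
have u0 I : 0 <= u I by apply: sume_ge0 => k _; exact: sib_term_ge0.
pose U I : R := fine (u I).
have U0 I : (0 <= U I)%R by exact: fine_ge0.
have uE I : I \in A -> u I = (U I)%:E.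
  move=> IA; rewrite fineK//; apply/sum_fin_numP => k _ _.
  by apply: sib_term_fin; apply: (anc_in c0 dE); exact: AE.
pose M I : R := fine (m I).
have ME I : I \in A -> m I = (M I)%:E.
  by move=> /Am/andP[_ h]; rewrite fineK// ge0_fin_numE.
(* The value for which 20 K eps^2 = eps / 2. *)
pose e : R := ((40 * K)^-1)%R.
have e0 : (0 < e)%R by rewrite invr_gt0 mulr_gt0.
pose a I : R := (e * U I)%R.
have a0 I : (0 <= a I)%R by rewrite mulr_ge0// ltW.
pose Y := undup [seq anc E L k | L <- A, k <- iota 0 n].
pose X := [seq J <- Y | 0 < w (sib E J)].
have uX : uniq X by rewrite filter_uniq// undup_uniq.
have XP J : J \in X -> exists I,
  [/\ I \in A, E J, hset I `<=` hset J & 0 < w (sib E J)].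
  rewrite mem_filter mem_undup => /andP[wJ /allpairsP[[I k]/= [IA _ JE]]].
  rewrite JE in wJ *; exists I; split => //;
    first exact: (anc_in c0 dE k (AE _ IA)).
  exact: (anc_sub c0 dE k (AE _ IA)).
have XE : {in X, forall J, E J} by move=> L LX; have [I' []] := XP L LX.
have Xw : {in X, forall J, 0 < w (sib E J) < +oo}.
  by move=> L LX; have [I' [_ EL _ ->]] := XP L LX; exact: sib_lty.
have Xmu : {in X, forall J, 0 < mu (box J) < +oo}.
  move=> J JX; have [I [IA EJ IJ wJ]] := XP _ JX; apply/andP; split.
    have /andP[mI _] := Am _ IA; apply: lt_le_trans mI _.
    rewrite -(whitney_point (AE _ IA)) le_measure ?inE//.
    - exact: measurable_point.
    - exact: measurable_box.
    - by move=> _ ->; apply/(box_whitney c0 dE (AE _ IA) EJ).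
  rewrite ltey; apply/eqP => muoo; have := hU EJ; rewrite muoo gt0_muley//.
  by rewrite mule_gt0// lte_fin exprn_gt0// invr_gt0 exprn_gt0//
    (hlen_gt0 c0 dE).
have goo : \int[mu]_z (atoms A a z ^+ 2)%:E =
    (\sum_(I <- A) a I ^+ 2 * M I)%:E.
  rewrite integral_atoms_sqr// -sumEFin; apply: eq_big_seq => I IA.
  by rewrite (ME _ IA).
have := bilinear_bound c0 dE K0 hU hT hTstar uX XE Xw Xmu mf
  (measurable_atoms A a) f0 (atoms_ge0 A a0) foo.
rewrite goo ltry => /(_ isT) bb.
have uX_le I : I \in A -> u I <=
  \sum_(J <- X | `[< hset I `<=` hset J >]) sib_term E w f J.
  move=> IA; rewrite /u /index_iota subn0.
  rewrite -(big_map (anc E I) xpredT (sib_term E w f))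
    (bigID (fun J => 0 < w (sib E J)))/=.
  rewrite [X in _ + X]big1 ?adde0; last first.
    move=> J; rewrite lt0e measure_ge0 andbT negbK => /eqP; exact: sib_term0.
  rewrite -big_filter -[leRHS]big_filter; apply: sum_le_subset.
  - by rewrite filter_uniq// map_inj_uniq ?iota_uniq// => i j;
      exact: (anc_inj c0 dE (AE _ IA)).
  - exact: filter_uniq.
  - move=> J; rewrite !mem_filter => /andP[-> /mapP[k kn ->]] /=.
    apply/andP; split; first by apply/asboolP;
      exact: (anc_sub c0 dE k (AE _ IA)).
    by rewrite mem_undup; apply/allpairsP; exists (I, k).
  - by move=> J; exact: sib_term_ge0.
have {bb} : (\sum_(I <- A) M I * a I * U I)%:E <=
    (20 * K)%:E * (\int[w]_x (f x ^+ 2)%:E + (\sum_(I <- A) a I ^+ 2 * M I)%:E).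
  apply: le_trans bb.
  rewrite -sumEFin [leRHS](eq_big_seq (fun J => \sum_(I <- A)
    if `[< hset I `<=` hset J >] then (a I)%:E * m I *
      sib_term E w f J else 0)); last first.
    move=> J JX; rewrite integral_atoms//; last exact: XE.
    rewrite muleC ge0_sume_distrl; last first.
      by move=> I _; rewrite mule_ge0 ?lee_fin//; case: ifP.
    by apply: eq_bigr => I _; case: ifP => // _; rewrite mule0 mul0e.
  rewrite exchange_big/= big_seq [leRHS]big_seq; apply: lee_sum => I IA.
  rewrite -big_mkcond/= -ge0_sume_distrr; last by move=> J _;
    exact: sib_term_ge0.
  rewrite [(M I * a I)%R]mulrC !EFinM -(ME _ IA) -(uE _ IA) lee_wpmul2l
    ?uX_le//.
  by rewrite !mule_ge0// lee_fin ltW.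
rewrite (eq_big_seq (fun I => (M I * U I ^+ 2)%:E)); last first.
  by move=> I IA; rewrite -/(u I) (ME _ IA) (uE _ IA) -EFin_expe -EFinM.
rewrite sumEFin.
have -> : (\sum_(I <- A) M I * a I * U I = e * \sum_(I <- A) M I * U I ^+ 2)%R.
  by rewrite mulr_sumr; apply: eq_bigr => I _; rewrite /a; ring.
have -> : (\sum_(I <- A) a I ^+ 2 * M I =
  e ^+ 2 * \sum_(I <- A) M I * U I ^+ 2)%R.
  by rewrite mulr_sumr; apply: eq_bigr => I _; rewrite /a; ring.
have : 0 <= \int[w]_x (f x ^+ 2)%:E.
  by apply: integral_ge0 => x _; rewrite lee_fin sqr_ge0.
move: foo; case: (\int[w]_x _) => [F _|//|//]; rewrite lee_fin => F0.
rewrite -EFinD -!EFinM !lee_fin; move: (\sum_(I <- A) _)%R => S.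
have -> : (20 * K * (F + e ^+ 2 * S) = 20 * K * F + e / 2 * S)%R.
  by rewrite /e; field; rewrite gt_eqF.
have eK : (e * (40 * K) = 1)%R by rewrite mulVf// gt_eqF// mulr_gt0.
move=> h; have {}h : (e * S <= 40 * K * F)%R by lra.
have : (e * S * (40 * K) <= 40 * K * F * (40 * K))%R.
  by rewrite ler_wpM2r// mulr_ge0// ltW.
rewrite mulrAC eK mul1r; nra.
Qed.

End Sufficiency.
End Whitney.

(** * Sufficiency and necessity of the testing conditions *)

Section Characterization.
Context {R : realType}.
Local Open Scope ereal_scope.
Context {c : R} (c0 : (0 < c)%R) {E : set (hoi R)} (dE : dyadic_system c E).
Context {m : hoi R -> \bar R} (m0 : forall I, 0 <= m I).

Let mu : {measure set (measurableTypeR R * measurableTypeR R) -> \bar R} :=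
  whitney_measure E m0.

Variables (w : {measure set (measurableTypeR R) -> \bar R}).
Hypothesis hw : forall I, E I -> w (hset I) < +oo.

Lemma inL2E (h : R -> R) : inL2 w h ->
  'N[w]_2%:E[EFin \o h] ^+ 2 = \int[w]_x (`|h x| ^+ 2)%:E /\
  \int[w]_x (`|h x| ^+ 2)%:E < +oo.
Proof.
move=> [mh]; rewrite /finite_norm => hoo.
have N2 : 'N[w]_2%:E[EFin \o h] ^+ 2 = \int[w]_x (`|h x| ^+ 2)%:E.
  rewrite Lnorm2E; apply: eq_integral => x _.
  by rewrite real_normK ?num_real.
by rewrite -N2 expe2 lte_mul_pinfty// ?ge0_fin_numE ?Lnorm_ge0.
Qed.

Section Sufficiency.
Variables (K : R) (K0 : (0 < K)%R).
Hypothesis hU : forall J, E J ->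
  ((hlen J ^- 2) ^+ 2)%:E * w (sib E J) * mu (box J) <= (K ^+ 2)%:E.
Hypothesis hT : forall J, E J -> 0 < w (hset J) < +oo ->
  \int[mu]_z (testT E w J z ^+ 2) <= (K ^+ 2)%:E * w (hset J).
Hypothesis hTstar : forall J, E J -> 0 < mu (box J) < +oo ->
  \int[w]_x (testTstar E mu J x ^+ 2) <= (K ^+ 2)%:E * mu (box J).

Section Nonneg.
Variable f : R -> R.
Hypothesis mf : measurable_fun [set: measurableTypeR R] f.
Hypothesis f0 : forall x, (0 <= f x)%R.
Hypothesis foo : \int[w]_x (f x ^+ 2)%:E < +oo.

Let Q I := dyadic_poisson E w (fun x => \1_(~` hset I) x * f x)%R I.
Let u I n := \sum_(0 <= k < n) sib_term E w f (anc E I k).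
Let u_ge0 I n : 0 <= u I n.
Proof. by apply: sume_ge0 => k _; exact: sib_term_ge0. Qed.

Lemma poisson_ge0 I : 0 <= Q I.
Proof.
apply: nneseries_ge0 => j _ _; rewrite mule_ge0 ?lee_fin ?invr_ge0 ?sqr_ge0//.
by apply: integral_ge0 => x _; rewrite lee_fin mulr_ge0.
Qed.

(** The condition U forces w to vanish on the siblings of all ancestors of an
    interval that carries infinite mass. *)
Let infinite_mass I : E I -> m I = +oo -> Q I = 0.
Proof.
move=> EI mI; apply/eqP; rewrite eq_le poisson_ge0 andbT.
apply: le_trans (poisson_le c0 dE w mf f0 EI) _.
rewrite eseries0// => k _ _; have EA := anc_in c0 dE k EI.
have muoo : mu (box (anc E I k)) = +oo.
  apply/eqP; rewrite -leye_eq -mI -(whitney_point m0 EI) le_measure ?inE//.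
  - exact: measurable_point.
  - exact: measurable_box.
  - by move=> _ ->; apply/(box_whitney c0 dE EI EA)/(anc_sub c0 dE k EI).
have := hU EA; rewrite muoo; have := measure_ge0 w (sib E (anc E I k)).
rewrite le_eqVlt => /orP[/eqP/esym w0 _|w0].
  rewrite /sib_term null_set_integral ?mule0//; first exact: measurable_sib.
  by apply/measurable_EFinP; exact: measurable_funTS.
rewrite gt0_muley// mule_gt0// lte_fin exprn_gt0// invr_gt0 exprn_gt0//.
exact: (hlen_gt0 c0 dE EA).
Qed.

Lemma poisson_sum_le (A : seq (hoi R)) : uniq A -> {in A, forall I, E I} ->
  \sum_(I <- A) m I * Q I ^+ 2 <= ((40 * K) ^+ 2)%:E * \int[w]_x (f x ^+ 2)%:E.
Proof.
move=> uA AE; pose A' := [seq I <- A | 0 < m I < +oo].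
have uA' : uniq A' by exact: filter_uniq.
have A'E : {in A', forall I, E I} by move=> L; rewrite mem_filter => /andP[_];
  exact: AE.
have A'm : {in A', forall I, 0 < m I < +oo} by move=> L;
  rewrite mem_filter => /andP[].
have -> : \sum_(I <- A) m I * Q I ^+ 2 = \sum_(I <- A') m I * Q I ^+ 2.
  rewrite big_filter (bigID (fun I => 0 < m I < +oo))/=.
  rewrite big_seq_cond [X in _ + X]big_seq_cond [X in _ + X]big1; last first.
    move=> I /andP[IA]; rewrite negb_and -leNgt -leNgt => /orP[mI|].
      by rewrite (_ : m I = 0) ?mul0e//; apply/eqP; rewrite eq_le mI m0.
    rewrite leye_eq => /eqP mI; rewrite (infinite_mass (AE _ IA) mI).
    by rewrite !mule0.
  by rewrite adde0 -big_seq_cond.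
pose U I := limn (u I).
have ndu I : {homo u I : n p / (n <= p)%N >-> n <= p}.
  by apply: ereal_nondecreasing_series => k _ _; exact: sib_term_ge0.
have cu I : u I @ \oo --> U I.
  by apply: ereal_nondecreasing_is_cvgn; exact: ndu.
have U0 I : 0 <= U I by apply: lime_ge; [exact: cu|exact: nearW].
apply: (@le_trans _ _ (\sum_(I <- A') m I * U I ^+ 2)).
  apply: lee_sum_mul_sqr => // [I|I IA]; first exact: poisson_ge0.
  exact: (poisson_le c0 dE w mf f0 (A'E _ IA)).
have cs : (fun n => \sum_(I <- A') m I * u I n ^+ 2) @ \oo -->
    \sum_(I <- A') m I * U I ^+ 2.
  rewrite big_seq_cond; under eq_fun do rewrite big_seq_cond.
  apply: cvg_nnesum => I; rewrite andbT => /A'm/andP[mI mIoo].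
    by apply: nearW => n; rewrite mule_ge0// sqre_ge0.
  apply: cvgeZl; first by rewrite ge0_fin_numE.
  have mdef : U I *? U I.
    by rewrite /mule_def; case: (U I) (U0 I) => [r||]//= r0;
      rewrite ?andbF ?orbF ?andbT.
  exact: cvgeM mdef (cu I) (cu I).
rewrite -(cvg_lim _ cs)//; apply: lime_le; first by apply/cvg_ex; eexists;
  exact: cs.
apply: nearW => n.
exact: (finite_sum_bound c0 dE hw K0 hU hT hTstar mf f0 foo n uA' A'E A'm).
Qed.

Lemma poisson_esum_le :
  \esum_(I in E) m I * Q I ^+ 2 <= ((40 * K) ^+ 2)%:E * \int[w]_x (f x ^+ 2)%:E.
Proof.
apply: ge_ereal_sup => _ [A [fA AE] <-]; rewrite fsbig_finite//=.
apply: poisson_sum_le; first exact: finmap.fset_uniq.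
by move=> I; rewrite in_fset_set// inE; exact: AE.
Qed.

End Nonneg.

(** For signed h the bound for |h| shows that the series of |h| converges at
    every I with m I > 0. *)
Theorem testing_sufficient : poisson_bound E w m (40 * K).
Proof.
move=> h hL2; have [N2 foo] := inL2E hL2; have [mh _] := hL2.
have mf : measurable_fun [set: measurableTypeR R] (fun x => `|h x|)%R.
  exact: measurableT_comp.
have f0 x : (0 <= `|h x|)%R by [].
have le := poisson_esum_le mf f0 foo; rewrite N2.
apply: le_trans le; apply: le_esum => I EI.
apply: lee_mul_sqr => //; first exact: poisson_abs.
apply: le_lt_trans (_ : _ <= ((40 * K) ^+ 2)%:E * \int[w]_x (`|h x| ^+ 2)%:E) _.
  have := @poisson_sum_le _ mf f0 foo [:: I]; rewrite big_seq1; apply => //.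
  by move=> L; rewrite inE => /eqP ->.
by rewrite lte_mul_pinfty// lee_fin sqr_ge0.
Qed.

End Sufficiency.

(** An interval is determined by its length and a rational point in it. Being
    countable, E allows testTstar to be approximated by an increasing sequence
    of finite sums. *)
Lemma dyadic_enum : exists e : nat -> hoi R, forall I, E I -> exists n, I = e n.
Proof.
pose e (p : int * rat) : hoi R := xget hempty
  [set I | [/\ E I, hlen I = (c * 2 ^ p.1)%R & hset I (ratr p.2)]].
exists (fun n => if unpickle n is Some p then e p else hempty) => I EI.
have [len _ _] := dE; have [k Ik] := len _ EI.
have I12 : (I.1 < I.2)%R by rewrite -subr_gt0; exact: (hlen_gt0 c0 dE EI).
have [q] := rat_in_itvoo I12; rewrite in_itv/= => /andP[q1 q2].
have Iq : hset I (ratr q) by apply/hsetP; split => //; exact: ltW.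
exists (pickle (k, q)); rewrite pickleK /e.
case: xgetP => [J _ [EJ Jk Jq]|/(_ I)/=]; last by case.
by apply: (eq_len_meet c0 dE EI EJ Iq Jq); rewrite Ik Jk.
Qed.

Section Necessity.
Variables (C : R) (C0 : (0 < C)%R).
Hypothesis pb : poisson_bound E w m C.

Let V (h : R -> R) I := \esum_(J in E `&` [set J | hset I `<=` hset J]) sib_term
  E w h J.

(** The Poisson inequality in terms of siblings; the factor 4 is that of
    [poisson_ge]. *)
Lemma sib_sum_bound (h : R -> R) : measurable_fun [set: measurableTypeR R] h ->
  (forall x, 0 <= h x)%R -> \int[w]_x (h x ^+ 2)%:E < +oo ->
  \esum_(I in E) m I * V h I ^+ 2 <=
  ((4 * C) ^+ 2)%:E * \int[w]_x (h x ^+ 2)%:E.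
Proof.
move=> mh h0 hoo.
have N2 : 'N[w]_2%:E[EFin \o h] ^+ 2 = \int[w]_x (h x ^+ 2)%:E.
  by rewrite Lnorm2E.
have hL2 : inL2 w h.
  split => //; rewrite /finite_norm ltey; apply: contraTneq hoo => Noo.
  by rewrite -N2 Noo expe2 mulyy.
have V0 I : 0 <= V h I by apply: esum_ge0 => J _; exact: sib_term_ge0.
pose Q I := dyadic_poisson E w (fun x => \1_(~` hset I) x * h x)%R I.
have Q0 I : 0 <= Q I by exact: poisson_ge0.
apply: (@le_trans _ _ (\esum_(I in E) (16%:E * (m I * Q I ^+ 2)))).
  apply: le_esum => I EI; rewrite [leRHS]muleCA lee_wpmul2l//.
  have -> : 16%:E * Q I ^+ 2 = (4%:E * Q I) ^+ 2.
    rewrite !expe2 muleACA -EFinM; congr (_%:E * _); by ring.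
  rewrite lee_sqr ?mule_ge0 ?V0 ?Q0//; exact: (poisson_ge c0 dE w mh h0 EI).
apply: le_trans (le_esumZl _ _ _) _ => //.
  by move=> I; rewrite mule_ge0// sqre_ge0.
have := pb hL2; rewrite N2 => b.
rewrite exprMn (_ : (4 ^+ 2 = 16)%R); last by ring.
by rewrite EFinM -muleA lee_wpmul2l.
Qed.

Lemma sib_indicator_bound (A : set (measurableTypeR R)) :
  measurable A -> w A < +oo ->
  \esum_(I in E) m I * V (\1_A) I ^+ 2 <= ((4 * C) ^+ 2)%:E * w A.
Proof.
move=> mA Aoo.
have AE : \int[w]_x (\1_A x ^+ 2)%:E = w A.
  under eq_integral do rewrite indicator_sqr.
  by rewrite integral_indic// setIT.
rewrite -[in leRHS]AE; apply: sib_sum_bound => //; by rewrite AE.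
Qed.

(** Test on the indicator of sib J, keeping the term J of the sum. *)
Lemma necessary_U J : E J ->
  ((hlen J ^- 2) ^+ 2)%:E * w (sib E J) * mu (box J) <= ((4 * C) ^+ 2)%:E.
Proof.
move=> EJ; have ms := measurable_sib E J.
have woo : w (sib E J) < +oo by exact: (sib_lty c0 dE hw).
have := sib_indicator_bound ms woo.
have w0 := measure_ge0 w (sib E J).
move: w0; rewrite le_eqVlt => /orP[/eqP <- _|w0].
  by rewrite mule0 mul0e lee_fin sqr_ge0.
move=> H; rewrite -(@lee_pmul2r _ (w (sib E J))) ?ge0_fin_numE//;
  apply: le_trans H.
set l := (hlen J ^- 2)%R; set W := w (sib E J).
have l0 : (0 <= l)%R by rewrite invr_ge0 sqr_ge0.
have WE : W = (fine W)%:E by rewrite fineK// ge0_fin_numE ?measure_ge0.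
apply: (@le_trans _ _ (\esum_(I in E `&` [set I | hset I `<=` hset J])
    (((l * fine W) ^+ 2)%:E * m I))).
  rewrite (whitney_box c0 dE m0 EJ) WE -EFinM muleAC -EFinM.
  rewrite (_ : (l ^+ 2 * fine W * fine W = (l * fine W) ^+ 2)%R); last by ring.
  by apply: esumZl_le => //; exact: sqr_ge0.
rewrite esum_mkcondr; apply: le_esum => I EI; case: ifPn => [/set_mem/= IJ|_];
  last first.
  by rewrite mule_ge0// sqre_ge0.
rewrite muleC lee_wpmul2l// EFin_expe lee_sqr; last 2 first.
- by rewrite lee_fin mulr_ge0// fine_ge0// measure_ge0.
- by apply: esum_ge0 => L _; exact: sib_term_ge0.
apply: esum_ge; exists [set J]; first by split => // _ ->.
rewrite fsbig_set1 /sib_term integral_indic// setIid -/W WE EFinM.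
by [].
Qed.

(** Test on the indicator of J: the siblings occurring in testT J lie in J. *)
Lemma necessary_T J : E J ->
  \int[mu]_z (testT E w J z ^+ 2) <= ((4 * C) ^+ 2)%:E * w (hset J).
Proof.
move=> EJ; apply: le_trans (sib_indicator_bound (measurable_hset J) (hw EJ)).
have T0 z : 0 <= testT E w J z.
  by apply: esum_ge0 => I _;
    rewrite mule_ge0// lee_fin mulr_ge0// invr_ge0 sqr_ge0.
apply: le_trans (integral_whitney_le _ _) _; first by move=> z; exact: sqre_ge0.
apply: le_esum => L EL; rewrite lee_wpmul2l// lee_sqr//; last first.
  by apply: esum_ge0 => I _; exact: sib_term_ge0.
rewrite /testT /V esum_mkcondr [leRHS]esum_mkcondr; apply: le_esum => I EI.
have s0 : 0 <= sib_term E w \1_(hset J) I by exact: sib_term_ge0.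
case: ifPn => [/set_mem/= IJ|_]; last by case: ifP.
rewrite indicE;
  have [/set_mem/(box_whitney c0 dE EL EI) LI|_] := boolP (_ \in _); last first.
  by rewrite mul0r mul0e; case: ifP.
rewrite mem_set//= mul1r /sib_term integral_indic//; last 2 first.
- exact: measurable_sib.
- exact: measurable_hset.
by rewrite setIidr//; exact: (sib_sub c0 dE EI EJ IJ).
Qed.

Section PartialSums.
Variables (J : hoi R) (EJ : E J) (Joo : mu (box J) < +oo).
Variables (Y : seq (hoi R)) (uY : uniq Y).
Hypothesis YJ : {in Y, forall I, E I /\ hset I `<` hset J}.

Let a I : R := (fine (mu (box I)) * hlen I ^- 2)%R.
Let a0 I : (0 <= a I)%R.
Proof. by rewrite mulr_ge0// ?invr_ge0 ?sqr_ge0// fine_ge0. Qed.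
Let h x : R := (\sum_(I <- Y) a I * \1_(sib E I) x)%R.
Let h0 x : (0 <= h x)%R.
Proof. by apply: sumr_ge0 => I _; rewrite mulr_ge0. Qed.
Let mh : measurable_fun [set: measurableTypeR R] h.
Proof. by apply: measurable_simple => I; exact: measurable_sib. Qed.

Let box_fin I : I \in Y -> mu (box I) = (fine (mu (box I)))%:E.
Proof.
move=> /YJ[EI [IJ _]]; rewrite fineK// ge0_fin_numE//; apply: le_lt_trans Joo.
by rewrite le_measure ?inE//; [exact: measurable_box|exact: measurable_box|
  exact: (box_sub (hlen_gt0 c0 dE EI))].
Qed.

Let hh_sum : \int[w]_x (h x ^+ 2)%:E =
  \sum_(I <- Y) mu (box I) * sib_term E w h I.
Proof.
under eq_integral do rewrite expr2 {2}/h mulr_sumr -sumEFin.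
rewrite ge0_integral_sum//; last 2 first.
- move=> I; apply/measurable_EFinP; apply: measurable_funM => //.
  by apply: measurable_funM => //; apply: measurable_indic;
    exact: measurable_sib.
- by move=> I x _; rewrite lee_fin mulr_ge0// mulr_ge0.
apply: eq_big_seq => I IY; rewrite (box_fin IY) /sib_term muleA -EFinM -/(a I).
rewrite [in RHS]integral_mkcond -ge0_integralZl_EFin//.
- apply: eq_integral => x _; rewrite patchE indicE.
  by case: (x \in _); rewrite ?mulr1 ?mulr0 ?mule0// -EFinM mulrC.
- by move=> x _; rewrite patchE; case: ifP; rewrite ?lee_fin.
- apply/(measurable_restrictT _ _).1; first exact: measurable_sib.
  by apply/measurable_EFinP; exact: measurable_funTS.
Qed.

Let sib_term_lty I : E I -> sib_term E w h I < +oo.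
Proof.
move=> EI; rewrite lte_mul_pinfty ?lee_fin ?invr_ge0 ?sqr_ge0//.
apply: le_lt_trans (_ : _ <= \int[w]_x (h x)%:E) _.
  apply: ge0_subset_integral => //; first exact: measurable_sib.
  - exact/measurable_EFinP.
  - by move=> x _; rewrite lee_fin.
rewrite integral_simple//; last by move=> L; exact: measurable_sib.
rewrite big_seq; apply: lte_sum_pinfty => L /YJ[EL _].
by rewrite lte_mul_pinfty ?lee_fin// (sib_lty c0 dE hw).
Qed.

Let hoo : \int[w]_x (h x ^+ 2)%:E < +oo.
Proof.
rewrite hh_sum big_seq; apply: lte_sum_pinfty => I IY.
have [EI _] := YJ IY.
rewrite (box_fin IY) lte_mul_pinfty ?lee_fin ?fine_ge0// sib_term_lty//.
Qed.

(** Here h is a finite partial sum of testTstar J. Its square integral X is a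
    part of the bilinear form at h and 1_(box J), hence at most the sum of the
    m_I V_I over the I contained in J. By AM-GM this is at most half of
    (4 C)^-2 sum of the m_I V_I^2, plus half of (4 C)^2 mu (box J); the former
    is at most X / 2 by [sib_sum_bound]. *)
Lemma partial_sum_bound :
  \int[w]_x (h x ^+ 2)%:E <= ((4 * C) ^+ 2)%:E * mu (box J).
Proof.
have V0 I : 0 <= V h I by apply: esum_ge0 => L _; exact: sib_term_ge0.
have s0 I : 0 <= sib_term E w h I by exact: sib_term_ge0.
have key : \int[w]_x (h x ^+ 2)%:E <=
    \esum_(I in E `&` [set I | hset I `<=` hset J]) m I * V h I.
  rewrite hh_sum; apply: (@le_trans _ _ (\sum_(I <- Y) \esum_(L in E)
     (if L \in [set L | hset L `<=` hset I] then m L *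
       sib_term E w h I else 0))).
    rewrite big_seq [leRHS]big_seq; apply: lee_sum => I /YJ[EI _].
    rewrite -esum_mkcondr (whitney_box c0 dE m0 EI) muleC.
    have -> : sib_term E w h I = (fine (sib_term E w h I))%:E.
      by rewrite fineK// ge0_fin_numE// sib_term_lty.
    under [leRHS]eq_esum do rewrite muleC.
    by apply: esumZl_le => //; exact: fine_ge0.
  rewrite -esum_sum; last first.
    by move=> L I _ _; case: ifP => // _; rewrite mule_ge0.
  rewrite [leRHS]esum_mkcondr; apply: le_esum => L EL.
  case: ifPn => [_|/negP LJ].
    rewrite -big_mkcond/= -ge0_sume_distrr// lee_wpmul2l//.
    apply: sum_le_esum => // I /YJ[EI _] /set_mem LI; split => //.
  rewrite big_seq big1// => I /YJ[EI [IJ _]]; case: ifPn => // /set_mem LI.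
  by case: LJ; apply/mem_set; exact: subset_trans LI IJ.
have B := sib_sum_bound mh h0 hoo.
have Z : \int[w]_x (h x ^+ 2)%:E <= (2^-1)%:E * (\int[w]_x (h x ^+ 2)%:E +
    ((4 * C) ^+ 2)%:E * mu (box J)).
  apply: le_trans key _; set K := (4 * C)%R in B *.
  have K0 : (0 < K)%R by rewrite mulr_gt0.
  have mV I : m I * V h I <= (K ^- 2 / 2)%:E * (m I * V h I ^+ 2) +
      (K ^+ 2 / 2)%:E * m I.
    rewrite muleCA [X in _ <= _ + X]muleC -ge0_muleDr//; last 2 first.
    - by rewrite mule_ge0 ?sqre_ge0// lee_fin divr_ge0// invr_ge0 sqr_ge0.
    - by rewrite lee_fin divr_ge0// sqr_ge0.
    rewrite lee_wpmul2l//; have := V0 I; case: (V h I) => [r r0|_|//].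
      rewrite -EFin_expe -EFinM -EFinD lee_fin -subr_ge0.
      rewrite [leRHS](_ : _ = (r / K - K) ^+ 2 / 2)%R; last first.
        by field; rewrite gt_eqF.
      by rewrite divr_ge0// sqr_ge0.
    rewrite expe2 mulyy gt0_muley ?addye// lte_fin divr_gt0// invr_gt0
      exprn_gt0//.
  apply: le_trans (le_esum (fun I _ => mV I)) _.
  rewrite esumD; last 2 first.
  - by move=> I _;
      rewrite !mule_ge0 ?sqre_ge0// lee_fin divr_ge0// invr_ge0 sqr_ge0.
  - by move=> I _; rewrite mule_ge0// lee_fin divr_ge0// sqr_ge0.
  rewrite ge0_muleDr; last 2 first.
  - by apply: integral_ge0 => x _; rewrite lee_fin sqr_ge0.
  - by rewrite mule_ge0// lee_fin sqr_ge0.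
  apply: leeD.
    apply: le_trans (le_esumZl _ _ _) _.
    - by rewrite divr_ge0// invr_ge0 sqr_ge0.
    - by move=> I; rewrite mule_ge0 ?sqre_ge0.
    apply: (@le_trans _ _ ((K ^- 2 / 2)%:E * \esum_(I in E) m I * V h I ^+ 2)).
      rewrite lee_wpmul2l ?lee_fin ?divr_ge0 ?invr_ge0 ?sqr_ge0//.
      rewrite esum_mkcondr; apply: le_esum => I EI; case: ifP => // _.
      by rewrite mule_ge0 ?sqre_ge0.
    apply: le_trans (lee_wpmul2l _ B) _.
      by rewrite lee_fin divr_ge0// invr_ge0 sqr_ge0.
    rewrite muleA -EFinM (_ : K ^- 2 / 2 * K ^+ 2 = 2^-1)%R//.
    by field; rewrite gt_eqF.
  apply: le_trans (le_esumZl _ _ _) _ => //.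
    by rewrite divr_ge0// sqr_ge0.
  by rewrite -(whitney_box c0 dE m0 EJ) muleA -EFinM mulrC.
have : 0 <= \int[w]_x (h x ^+ 2)%:E.
  by apply: integral_ge0 => x _; rewrite lee_fin sqr_ge0.
have Mfin : mu (box J) \is a fin_num by rewrite ge0_fin_numE.
move: Z hoo; rewrite -(fineK Mfin); case: (\int[w]_x _) => [X| |]// + _.
rewrite -[X in _ <= _ * (_ + X)]EFinM -EFinD -!EFinM !lee_fin; lra.
Qed.

End PartialSums.

(** Monotone convergence along an enumeration of E. *)
Lemma necessary_Tstar J : E J ->
  \int[w]_x (testTstar E mu J x ^+ 2) <= ((4 * C) ^+ 2)%:E * mu (box J).
Proof.
move=> EJ; have [Moo|] := eqVneq (mu (box J)) +oo.
  by rewrite Moo gt0_muley ?leey// lte_fin exprn_gt0// mulr_gt0.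
rewrite -ltey => Joo; have [e eE] := dyadic_enum.
pose Y n := [seq I <- undup (map e (iota 0 n)) |
  `[< E I /\ hset I `<` hset J >]].
have uY n : uniq (Y n) by rewrite filter_uniq// undup_uniq.
have YP n I : I \in Y n -> E I /\ hset I `<` hset J.
  by rewrite mem_filter => /andP[/asboolP].
have Ymono n p : (n <= p)%N -> {subset Y n <= Y p}.
  move=> np I; rewrite !mem_filter !mem_undup => /andP[-> /mapP[k]].
  rewrite mem_iota add0n => /andP[_ kn] ->; apply: map_f.
  by rewrite mem_iota add0n/= (leq_trans kn).
have exhaust (s : seq (hoi R)) :
    (forall I, I \in s -> E I /\ hset I `<` hset J) ->
    exists N, {subset s <= Y N}.
  elim: s => [_|I s ih sJ]; first by exists 0%N.
  have [|N sN] := ih; first by move=> I' I's; apply: sJ; rewrite inE I's orbT.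
  have IJ := sJ I (mem_head _ _); have [n In] := eE _ IJ.1.
  exists (maxn N n.+1) => I'; rewrite inE => /orP[/eqP ->|/sN]; last first.
    by apply: Ymono; rewrite leq_maxl.
  apply: (Ymono n.+1); first by rewrite leq_maxr.
  rewrite mem_filter mem_undup; apply/andP; split; first exact/asboolP.
  by rewrite {1}In map_f// mem_iota add0n/=.
pose a I : R := (fine (mu (box I)) * hlen I ^- 2)%R.
have a0 I : (0 <= a I)%R.
  by rewrite mulr_ge0// ?invr_ge0 ?sqr_ge0// fine_ge0.
pose h n x : R := (\sum_(I <- Y n) a I * \1_(sib E I) x)%R.
have h0 n x : (0 <= h n x)%R by apply: sumr_ge0 => I _; rewrite mulr_ge0.
have mh n : measurable_fun [set: measurableTypeR R] (h n).
  by apply: measurable_simple => I; exact: measurable_sib.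
have hmono x n p : (n <= p)%N -> (h n x <= h p x)%R.
  move=> np; rewrite -lee_fin -!sumEFin; apply: sum_le_subset => //.
    exact: Ymono.
  by move=> I; rewrite lee_fin mulr_ge0.
pose g n x := (h n x ^+ 2)%:E.
have gmono x : {homo g^~ x : n p / (n <= p)%N >-> n <= p}.
  by move=> n p np; rewrite lee_fin ler_sqr ?nnegrE// hmono.
have mg n : measurable_fun [set: measurableTypeR R] (g n).
  by apply/measurable_EFinP; exact: measurable_funX.
have g0 n x : 0 <= g n x by rewrite lee_fin sqr_ge0.
have T0 x : 0 <= testTstar E mu J x.
  by apply: esum_ge0 => I _; rewrite !mule_ge0// lee_fin// invr_ge0 sqr_ge0.
apply: (@le_trans _ _ (\int[w]_x limn (g^~ x))).
  apply: le_integral_ge0 => x; first exact: sqre_ge0.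
  have ndh : {homo (fun n => (h n x)%:E) : n p / (n <= p)%N >-> n <= p}.
    by move=> n p np; rewrite lee_fin hmono.
  pose L := limn (fun n => (h n x)%:E).
  have cL : (fun n => (h n x)%:E) @ \oo --> L by exact:
    ereal_nondecreasing_is_cvgn.
  have L0 : 0 <= L by apply: lime_ge;
    [exact: cL|apply: nearW => n; rewrite lee_fin].
  have mdef : L *? L.
    by rewrite /mule_def; case: (L) L0 => [r||]//= r0;
      rewrite ?andbF ?orbF ?andbT.
  have -> : limn (g^~ x) = L ^+ 2.
    by apply: cvg_lim => //; exact: (cvgeM mdef cL cL).
  rewrite lee_sqr//; apply: ge_ereal_sup => _ [B [fB BE] <-].
  have [|N BN] := exhaust (finmap.enum_fset (fset_set B)).
    by move=> I; rewrite in_fset_set// inE => /BE.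
  rewrite fsbig_finite//=.
  apply: (@le_trans _ _ (h N x)%:E).
    rewrite -sumEFin; apply: (@le_trans _ _ (\sum_(I <- Y N)
        (\1_(sib E I) x)%:E * (mu (box I) * (hlen I ^- 2)%:E))).
      apply: sum_le_subset => //.
      - exact: finmap.fset_uniq.
      - by move=> I; rewrite !mule_ge0// lee_fin// invr_ge0 sqr_ge0.
    rewrite big_seq [leRHS]big_seq; apply: lee_sum => I /YP[EI [IJ _]].
    rewrite EFinM muleC EFinM fineK// ge0_fin_numE//; apply: le_lt_trans Joo.
    by rewrite le_measure ?inE//; [exact: measurable_box|exact: measurable_box|
      exact: (box_sub (hlen_gt0 c0 dE EI))].
  apply: lime_ge; first exact: cL.
  by exists N => // n /= Nn; exact: ndh.
rewrite (monotone_convergence w measurableT mg (fun n x _ => g0 n x)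
  (fun x _ => gmono x)).
apply: lime_le.
  apply: ereal_nondecreasing_is_cvgn => n p np.
  by apply: le_integral_ge0 => x; [exact: g0|exact: gmono].
by apply: nearW => n; exact: (partial_sum_bound EJ Joo (uY n) (YP n)).
Qed.

End Necessity.
End Characterization.

(** * The constants *)

Section Constants.
Context {R : realType}.
Local Open Scope ereal_scope.

Lemma quot0_sqrte_le (N a : \bar R) (K : R) : 0 <= N -> 0 <= a -> (0 <= K)%R ->
  N ^+ 2 <= (K ^+ 2)%:E * a -> quot0 N (sqrte a) <= K%:E.
Proof.
move=> N0 a0 K0; rewrite /quot0; case: eqP => [_ _|/eqP a1];
  first by rewrite lee_fin.
case: a a0 a1 => [a a0 a1 h|_ _ _|//]; last by rewrite /= /inve mule0 lee_fin.
have sa : (0 < Num.sqrt a)%R.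
  by rewrite lt_neqAle sqrtr_ge0 andbT eq_sym; move: a1; rewrite /= eqe.
rewrite /= inver gt_eqF// lee_pdivrMr// -lee_sqr//;
  last by rewrite lee_fin mulr_ge0// ltW.
by rewrite -EFinM -EFin_expe exprMn sqr_sqrtr// EFinM.
Qed.

Lemma le_quot0_sqrte (N a : \bar R) (K : R) : 0 <=
  N -> 0 < a < +oo -> (0 <= K)%R ->
  quot0 N (sqrte a) <= K%:E -> N ^+ 2 <= (K ^+ 2)%:E * a.
Proof.
move=> N0; case: a => [a| |]//=; last by rewrite ltxx andbF.
rewrite lte_fin ltry andbT => a0 K0.
have sa : (0 < Num.sqrt a)%R by rewrite sqrtr_gt0.
rewrite /quot0 eqe gt_eqF// inver gt_eqF// lee_pdivrMr// => h.
rewrite -[in leRHS](sqr_sqrtr (ltW a0)) -EFinM -exprMn EFin_expe lee_sqr//.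
by rewrite lee_fin mulr_ge0// ltW.
Qed.

Lemma sqr_mul_sqrte (l : R) (a b : \bar R) : 0 <= a -> 0 <= b ->
  (l%:E * sqrte a * sqrte b) ^+ 2 = (l ^+ 2)%:E * a * b.
Proof.
move=> a0 b0; rewrite -[in RHS](sqr_sqrte a0) -[in RHS](sqr_sqrte b0).
by rewrite !expe2 muleACA [X in X * _]muleACA.
Qed.

Variables (E : set (hoi R)) (w : {measure set (measurableTypeR R) -> \bar R}).
Variable mu : {measure set (measurableTypeR R * measurableTypeR R) -> \bar R}.

Let l0 (I : hoi R) : (0 <= hlen I ^- 2)%R.
Proof.
by rewrite invr_ge0 sqr_ge0.
Qed.

Lemma constU_le (K : R) : (0 <= K)%R -> constU E w mu <= K%:E <->
  forall J, E J -> ((hlen J ^- 2) ^+ 2)%:E * w (sib E J) * mu (box J) <=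
    (K ^+ 2)%:E.
Proof.
move=> K0; have p0 J : 0 <=
  (hlen J ^- 2)%:E * sqrte (w (sib E J)) * sqrte (mu (box J)).
  by rewrite !mule_ge0 ?lee_fin ?sqrte_ge0.
split=> [h J EJ|h].
  rewrite -sqr_mul_sqrte// EFin_expe lee_sqr//.
  by apply: le_trans h; apply: ereal_sup_ubound; exists J.
apply: ge_ereal_sup => _ [J EJ <-]; rewrite -lee_sqr ?lee_fin//.
by rewrite sqr_mul_sqrte// -EFin_expe; exact: h.
Qed.

Lemma constT_ge (K : R) : (0 <= K)%R -> constT E w mu <= K%:E ->
  forall J, E J -> 0 < w (hset J) < +oo ->
  \int[mu]_z (testT E w J z ^+ 2) <= (K ^+ 2)%:E * w (hset J).
Proof.
move=> K0 h J EJ wJ; rewrite -Lnorm2E; apply: le_quot0_sqrte => //.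
  exact: Lnorm_ge0.
by apply: le_trans h; apply: ereal_sup_ubound; exists J.
Qed.

Lemma constT_le (K : R) : (0 <= K)%R ->
  (forall J, E J -> \int[mu]_z (testT E w J z ^+ 2) <= (K ^+ 2)%:E * w (hset J))
    ->
  constT E w mu <= K%:E.
Proof.
move=> K0 h; apply: ge_ereal_sup => _ [J EJ <-]; apply: quot0_sqrte_le => //.
  exact: Lnorm_ge0.
by rewrite Lnorm2E; exact: h.
Qed.

Lemma constTstar_ge (K : R) : (0 <= K)%R -> constTstar E w mu <= K%:E ->
  forall J, E J -> 0 < mu (box J) < +oo ->
  \int[w]_x (testTstar E mu J x ^+ 2) <= (K ^+ 2)%:E * mu (box J).
Proof.
move=> K0 h J EJ wJ; rewrite -Lnorm2E; apply: le_quot0_sqrte => //.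
  exact: Lnorm_ge0.
by apply: le_trans h; apply: ereal_sup_ubound; exists J.
Qed.

Lemma constTstar_le (K : R) : (0 <= K)%R ->
  (forall J, E J -> \int[w]_x (testTstar E mu J x ^+ 2) <=
    (K ^+ 2)%:E * mu (box J)) ->
  constTstar E w mu <= K%:E.
Proof.
move=> K0 h; apply: ge_ereal_sup => _ [J EJ <-]; apply: quot0_sqrte_le => //.
  exact: Lnorm_ge0.
by rewrite Lnorm2E; exact: h.
Qed.

Lemma quot0_ge0 (a b : \bar R) : 0 <= a -> 0 <= b -> 0 <= quot0 a b.
Proof.
by move=> a0 b0; rewrite /quot0; case: ifP => // _; rewrite mule_ge0 ?inve_ge0.
Qed.

Lemma const_ge0 : E !=set0 ->
  [/\ 0 <= constU E w mu, 0 <= constT E w mu & 0 <= constTstar E w mu].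
Proof.
move=> [J EJ]; split; apply: ereal_sup_ge.
- exists ((hlen J ^- 2)%:E * sqrte (w (sib E J)) * sqrte (mu (box J)));
    first by exists J.
  by rewrite !mule_ge0 ?lee_fin ?sqrte_ge0.
- exists (quot0 'N[mu]_2%:E[testT E w J] (sqrte (w (hset J))));
    first by exists J.
  by rewrite quot0_ge0 ?Lnorm_ge0 ?sqrte_ge0.
- exists (quot0 'N[w]_2%:E[testTstar E mu J] (sqrte (mu (box J))));
    first by exists J.
  by rewrite quot0_ge0 ?Lnorm_ge0 ?sqrte_ge0.
Qed.

End Constants.

Section TwoWeight.
Context {R : realType}.
Local Open Scope ereal_scope.
Context {c : R} (c0 : (0 < c)%R) {E : set (hoi R)} (dE : dyadic_system c E).
Context {m : hoi R -> \bar R} (m0 : forall I, 0 <= m I).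
Variables (w : {measure set (measurableTypeR R) -> \bar R}).
Hypothesis hw : forall I, E I -> w (hset I) < +oo.

Let mu : {measure set (measurableTypeR R * measurableTypeR R) -> \bar R} :=
  whitney_measure E m0.
Let S := constU E w mu + constT E w mu + constTstar E w mu.

Let parts : [/\ 0 <= constU E w mu, 0 <= constT E w mu & 0 <=
  constTstar E w mu].
Proof.
by apply: const_ge0; have [_ cov _] := dE; have [I [EI _ _]] := cov 0%R 0%R;
  exists I.
Qed.

(** The tests need a positive constant, hence the perturbation of C. *)
Lemma constants_necessary (C : R) : (0 <= C)%R -> poisson_bound E w m C ->
  S <= (12 * C)%:E.
Proof.
move=> C0 pb; apply/lee_addgt0Pr => e e0.
pose D : R := (C + e / 12)%R.
have D0 : (0 < D)%R by rewrite ltr_wpDl// divr_gt0.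
have CD : (C <= D)%R by rewrite lerDl ltW// divr_gt0.
have pbD : poisson_bound E w m D.
  move=> h hL2; apply: le_trans (pb h hL2) _.
  rewrite lee_wpmul2r ?sqre_ge0// lee_fin ler_sqr ?nnegrE//; exact: ltW.
have K0 : (0 <= 4 * D)%R by rewrite mulr_ge0// ltW.
have -> : (12 * C)%:E + e%:E = (4 * D)%:E + (4 * D)%:E + (4 * D)%:E.
  by rewrite -!EFinD; congr EFin; rewrite /D; field.
apply: leeD; first apply: leeD.
- by apply/(constU_le E w mu K0) => J; exact: (necessary_U c0 dE m0 hw pbD).
- by apply: constT_le => // J; exact: (necessary_T c0 dE m0 hw pbD).
- by apply: constTstar_le => // J; exact: (necessary_Tstar c0 dE m0 hw D0 pbD).
Qed.

Lemma constants_sufficient (K : R) : (0 < K)%R -> S <= K%:E ->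
  poisson_bound E w m (40 * K).
Proof.
move=> K0 SK; have [U0 T0 Ts0] := parts; have K0' := ltW K0.
apply: (testing_sufficient c0 dE hw K0).
- apply/(constU_le E w mu K0'); apply: le_trans SK.
  by rewrite /S -addeA leeDl// adde_ge0.
- apply: (constT_ge K0'); apply: le_trans SK.
  by rewrite /S addeAC leeDr// adde_ge0.
- apply: (constTstar_ge K0'); apply: le_trans SK.
  by rewrite /S leeDr// adde_ge0.
Qed.

Theorem two_weight_testing :
  ((exists2 C : R, (0 <= C)%R & poisson_bound E w m C) <->
   [/\ constU E w mu < +oo, constT E w mu < +oo & constTstar E w mu < +oo]) /\
  (best_constant E w m <= 40%:E * S /\ S <= 40%:E * best_constant E w m).
Proof.
have [U0 T0 Ts0] := parts.
have S0 : 0 <= S by rewrite !adde_ge0.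
split; [split|split].
- move=> [C C0 pb]; have : S < +oo.
    exact: le_lt_trans (constants_necessary C0 pb) (ltry _).
  move=> Soo; split; apply: le_lt_trans Soo.
  + by rewrite /S -addeA leeDl// adde_ge0.
  + by rewrite /S addeAC leeDr// adde_ge0.
  + by rewrite /S leeDr// adde_ge0.
- move=> [Uoo Too Tsoo]; have Sfin : S \is a fin_num.
    by rewrite ge0_fin_numE// !lte_add_pinfty.
  have s0 : (0 < fine S + 1)%R by rewrite ltr_wpDl// fine_ge0.
  exists (40 * (fine S + 1))%R; first by rewrite mulr_ge0// ltW.
  apply: constants_sufficient => //.
  by rewrite EFinD fineK// leeDl.
- have [Soo|] := eqVneq S +oo; first by rewrite Soo gt0_muley ?lte_fin// leey.
  rewrite -ltey => Soo; have Sfin : S \is a fin_num by rewrite ge0_fin_numE.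
  apply/lee_addgt0Pr => e e0; rewrite -(fineK Sfin).
  have K0 : (0 < fine S + e / 40)%R by rewrite ltr_wpDl ?fine_ge0// divr_gt0.
  apply: ereal_inf_lbound; exists (40 * (fine S + e / 40))%R.
    split; first by rewrite mulr_ge0// ltW.
    apply: constants_sufficient => //.
    by rewrite EFinD fineK// leeDl// lee_fin ltW// divr_gt0.
  by rewrite -EFinM -EFinD; congr EFin; field.
- rewrite -lee_pdivrMl//; apply/ereal_infP => _ [C [C0 pb] <-].
  rewrite lee_pdivrMl//; apply: le_trans (constants_necessary C0 pb) _.
  by rewrite -EFinM lee_fin ler_wpM2r//; lra.
Qed.

End TwoWeight.

Lemma radon_hset_lty (R : realType) (w :
  {measure set (measurableTypeR R) -> \bar R})
  (I : hoi R) : radon w -> (w (hset I) < +oo)%E.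
Proof.
move=> [cpt _]; have := cpt `[I.1, I.2]%classic (@segment_compact _ _ _).
apply: le_lt_trans.
rewrite le_measure ?inE//; first exact: measurable_hset.
by move=> x /hsetP[x1 x2]; rewrite /= in_itv/= x1 ltW.
Qed.

Local Open Scope ereal_scope.

Theorem corollary6p5 (R : realType) :
  exists A : R, (0 < A)%R /\
  forall (sigma w : {measure set (measurableTypeR R) -> \bar R})
         (D : set (hoi R)) (Du : 'I_3 -> set (hoi R))
         (I0 : hoi R) (n : nat) (gamma : R) (r : nat) (SS : set (hoi R))
         (u : 'I_3),
    radon sigma -> radon w ->
    dyadic_system 1 D -> tripled_partition D Du -> D I0 ->
    (0 < gamma < 1)%R -> stopping D w I0 SS ->
    let m := mu_coef sigma D I0 n gamma r SS (Du u) in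
    let mu := whitney_measure (Du u)
                (mu_coef_ge0 sigma D I0 n gamma r SS (Du u)) in
    let U := constU (Du u) w mu in
    let T := constT (Du u) w mu in
    let Tstar := constTstar (Du u) w mu in
    let Q := best_constant (Du u) w m in
    ((exists2 C : R, (0 <= C)%R & poisson_bound (Du u) w m C) <->
     [/\ U < +oo, T < +oo & Tstar < +oo]) /\
    (Q <= A%:E * (U + T + Tstar) /\ U + T + Tstar <= A%:E * Q).
Proof.
exists 40%R; split=> // sigma w D Du I0 n gamma r SS u _ rw _ [dDu _ _] _ _ _.
exact: (two_weight_testing _ (dDu u) _ (fun I _ => radon_hset_lty I rw)).
Qed.
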